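(* Let $R$ be an analytically unramified one dimensional almost Gorenstein complete local ring. Then $$\mathrm{ca}(R)=\mathrm{co}(R).$$
   Context: All rings are commutative Noetherian and all modules are finitely generated; $\mathrm{mod}\,R$ is the category of finitely generated $R$-modules. A local ring is analytically unramified if its completion is reduced. Almost Gorenstein: a Cohen-Macaulay local ring $R$ with canonical module $\omega$ is almost Gorenstein if there is an exact sequence $0\to R\to\omega\to C\to 0$ of finitely generated $R$-modules such that the multiplicity of $C$ (with respect to the maximal ideal) equals the minimal number of generators of $C$. Conductor: $Q(R)$ is the total quotient ring of $R$, $\overline R$ is the integral closure of $R$ in $Q(R)$, and $\mathrm{co}(R)=\{r\in \overline R: r\overline R\subseteq R\}$, an ideal of $R$. Cohomology annihilator: for $n\ge 1$, $\mathrm{ca}^n(R)=\{r\in R: r\,\mathrm{Ext}_R^{i}(M,N)=0 \text{ for all } i\ge n \text{ and all } M,N\in\mathrm{mod}\,R\}$, and $\mathrm{ca}(R)=\bigcup_{n}\mathrm{ca}^n(R)$. *)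

(* Defs.v *)
From HB Require Import structures.
From mathcomp Require Import all_boot all_order all_algebra.
From mathcomp Require Import boolp classical_sets functions.

Set Implicit Arguments.
Unset Strict Implicit.
Unset Printing Implicit Defensive.

Import GRing.Theory.

Local Open Scope classical_set_scope.
Local Open Scope ring_scope.

(* Ideals and submodules are Prop-valued subsets; an ideal of R is a submodule
   of the regular module R^o. *)

Definition submodule (R : comNzRingType) (M : lmodType R) (S : set M) : Prop :=
  S 0 /\ forall (a : R) (x y : M), S x -> S y -> S (a *: x + y).

Definition submodule_span (R : comNzRingType) (M : lmodType R) (A : set M) :
    set M :=
  [set y | exists (n : nat) (c : 'I_n -> R) (x : 'I_n -> M),
     (forall i, A (x i)) /\ y = \sum_(i < n) c i *: x i].

Definition ideal (R : comNzRingType) (I : set R) : Prop :=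
  @submodule R R^o I.

Definition ideal_span (R : comNzRingType) (A : set R) : set R :=
  @submodule_span R R^o A.

Definition maximal_ideal (R : comNzRingType) (m : set R) : Prop :=
  [/\ ideal m, ~ m 1 &
      forall J : set R, ideal J -> m `<=` J -> ~ J 1 -> J = m].

Definition prime_ideal (R : comNzRingType) (P : set R) : Prop :=
  [/\ ideal P, ~ P 1 & forall x y : R, P (x * y) -> P x \/ P y].

(* [local_ring m]: R is local with maximal ideal m. *)
Definition local_ring (R : comNzRingType) (m : set R) : Prop :=
  maximal_ideal m /\ forall n : set R, maximal_ideal n -> n = m.

Definition noetherian (R : comNzRingType) : Prop :=
  forall I : set R, ideal I ->
    exists s : seq R, I = ideal_span [set x | x \in s].

Definition generates (R : comNzRingType) (M : lmodType R) (s : seq M) : Prop :=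
  submodule_span [set x | x \in s] = setT.

Definition fin_gen (R : comNzRingType) (M : lmodType R) : Prop :=
  exists s : seq M, generates s.

Definition min_number_gens (R : comNzRingType) (M : lmodType R) (k : nat) :
    Prop :=
  (exists2 s : seq M, size s = k & generates s) /\
  forall s : seq M, generates s -> (k <= size s)%N.

(* The submodule I S generated by the products a *: x, a in I, x in S. *)
Definition ideal_mul (R : comNzRingType) (M : lmodType R)
    (I : set R) (S : set M) : set M :=
  submodule_span [set y | exists a x, [/\ I a, S x & y = a *: x]].

(* I^n M *)
Definition adic (R : comNzRingType) (I : set R) (M : lmodType R) (n : nat) :
    set M :=
  iter n (@ideal_mul R M I) setT.

Arguments adic {R} I M n.

Definition ideal_pow (R : comNzRingType) (I : set R) (n : nat) : set R :=
  adic I R^o n.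

(* The supremum of the lengths l of strict chains c 0 < ... < c l of subsets
   satisfying P is attained and equal to l. *)
Definition chain (T : Type) (P : set (set T)) (l : nat) (c : nat -> set T) :
    Prop :=
  (forall i, (i <= l)%N -> P (c i)) /\
  (forall i, (i < l)%N -> c i `<=` c i.+1 /\ c i <> c i.+1).

Definition max_chain_length (T : Type) (P : set (set T)) (l : nat) : Prop :=
  (exists c, chain P l c) /\ forall k c, chain P k c -> (k <= l)%N.

Definition krull_dim (R : comNzRingType) (d : nat) : Prop :=
  max_chain_length [set P : set R | prime_ideal P] d.

Definition annihilator (R : comNzRingType) (M : lmodType R) : set R :=
  [set a | forall x : M, a *: x = 0].

(* dim M = dim (R / ann M); no d satisfies this when M = 0. *)
Definition module_dim (R : comNzRingType) (M : lmodType R) (d : nat) : Prop :=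
  max_chain_length
    [set P : set R | prime_ideal P /\ annihilator M `<=` P] d.

(* The length of the subquotient Z / B of M is l. *)
Definition subquotient_length (R : comNzRingType) (M : lmodType R)
    (B Z : set M) (l : nat) : Prop :=
  max_chain_length [set S | [/\ submodule S, B `<=` S & S `<=` Z]] l.

(* The multiplicity e(M) of a finitely generated M with respect to m: if
   s = dim M and p is the Hilbert-Samuel polynomial of M, then e(M) is s! times
   the coefficient of degree s of p.  By convention e(0) = 0. *)
Definition multiplicity (R : comNzRingType) (m : set R) (M : lmodType R)
    (e : nat) : Prop :=
  ((forall x : M, x = 0) /\ e = 0%N) \/
  exists (s : nat) (p : {poly rat}) (n0 : nat),
    [/\ module_dim M s,
        forall n, (n0 <= n)%N -> exists2 l : nat,
          subquotient_length (adic m M n) setT l & l%:R = p.[n%:R],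
        (size p <= s.+1)%N
      & e%:R = (s`!)%:R * p`_s].

Definition adically_complete (R : comNzRingType) (I : set R) : Prop :=
  (forall x : R, (forall n, ideal_pow I n x) -> x = 0) /\
  (forall u : nat -> R, (forall n, ideal_pow I n (u n.+1 - u n)) ->
     exists x : R, forall n, ideal_pow I n (x - u n)).

(* [adic_completion I j]: j exhibits Rh as the I-adic completion of R (for I
   finitely generated), i.e. Rh is complete for the topology of I Rh and j
   induces isomorphisms R / I^n -> Rh / I^n Rh. *)
Definition adic_completion (R Rh : comNzRingType) (I : set R)
    (j : {rmorphism R -> Rh}) : Prop :=
  let J := ideal_span [set j a | a in I] in
  [/\ adically_complete J,
      forall n x, ideal_pow J n (j x) <-> ideal_pow I n x
    & forall n y, exists x, ideal_pow J n (y - j x)].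

Definition reduced (R : comNzRingType) : Prop :=
  forall (x : R) (n : nat), x ^+ n = 0 -> x = 0.

(* Completions are unique up to isomorphism, so "the completion is reduced" may
   be stated for some completion. *)
Definition analytically_unramified (R : comNzRingType) (m : set R) : Prop :=
  exists (Rh : comNzRingType) (j : {rmorphism R -> Rh}),
    adic_completion m j /\ reduced Rh.

Definition total_quotient_ring (R : comNzRingType) (Q : comUnitRingType)
    (iota : {rmorphism R -> Q}) : Prop :=
  [/\ injective iota,
      forall s : R, GRing.lreg s -> iota s \is a GRing.unit
    & forall q : Q, exists a s : R, GRing.lreg s /\ q = iota a / iota s].

(* As a subset of Q(R). *)
Definition conductor (R : comNzRingType) (Q : comUnitRingType)
    (iota : {rmorphism R -> Q}) : set Q :=
  [set r | integralOver iota r /\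
     forall x : Q, integralOver iota x -> range iota (r * x)].

Definition projective_module (R : comNzRingType) (P : lmodType R) : Prop :=
  forall (A B : lmodType R) (g : {linear A -> B}) (f : {linear P -> B}),
    (forall b, exists a, g a = b) ->
    exists h : {linear P -> A}, forall x, g (h x) = f x.

Definition injective_module (R : comNzRingType) (E : lmodType R) : Prop :=
  forall (A B : lmodType R) (g : {linear A -> B}) (f : {linear A -> E}),
    injective g -> exists h : {linear B -> E}, forall x, h (g x) = f x.

Record projective_resolution (R : comNzRingType) (M : lmodType R) :=
  ProjectiveResolution {
    res_obj :> nat -> lmodType R;
    res_diff : forall i, {linear res_obj i.+1 -> res_obj i};
    res_aug : {linear res_obj 0 -> M};
    res_projective : forall i, projective_module (res_obj i);
    res_aug_surj : forall y, exists x, res_aug x = y;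
    res_aug_exact : forall x,
      res_aug x = 0 <-> exists z, res_diff 0 z = x;
    res_diff_exact : forall i x,
      res_diff i x = 0 <-> exists z, res_diff i.+1 z = x
  }.

(* Ext^i_R(M, N) is the i-th cohomology of Hom_R(F, N), with F a projective
   resolution of M: the subquotient [ext_cocycles] / [ext_coboundaries] of the
   R-module of functions F i -> N. *)
Definition ext_cocycles (R : comNzRingType) (M N : lmodType R)
    (F : projective_resolution M) (i : nat) : set (F i -> N) :=
  [set f : F i -> N | linear f /\ forall x, f (res_diff F i x) = 0].

Definition ext_coboundaries (R : comNzRingType) (M N : lmodType R)
    (F : projective_resolution M) (i : nat) : set (F i -> N) :=
  match i return set (F i -> N) with
  | 0 => [set (fun=> 0)]
  | j.+1 => [set f : F j.+1 -> N | exists2 g : F j -> N,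
                linear g & f = g \o res_diff F j]
  end.

Arguments ext_cocycles {R M} N F i.
Arguments ext_coboundaries {R M} N F i.

Definition kills_ext (R : comNzRingType) (r : R) (i : nat) (M N : lmodType R) :
    Prop :=
  forall (F : projective_resolution M) (f : F i -> N),
    ext_cocycles N F i f -> ext_coboundaries N F i (r *: f).

Definition cohomology_annihilator_from (R : comNzRingType) (n : nat) : set R :=
  [set r | forall (i : nat) (M N : lmodType R),
     (n <= i)%N -> fin_gen M -> fin_gen N -> kills_ext r i M N].

Arguments cohomology_annihilator_from R n : clear implicits.

Definition cohomology_annihilator (R : comNzRingType) : set R :=
  [set r | exists2 n, (1 <= n)%N & cohomology_annihilator_from R n r].

Arguments cohomology_annihilator R : clear implicits.

(* M-regular sequences contained in m. *)
Definition regular_sequence (R : comNzRingType) (m : set R) (M : lmodType R)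
    (s : seq R) : Prop :=
  [/\ forall x, x \in s -> m x,
      forall i (y : M), (i < size s)%N ->
        ideal_mul [set x | x \in take i s] setT (s`_i *: y) ->
        ideal_mul [set x | x \in take i s] setT y
    & ideal_mul [set x | x \in s] [set: M] <> setT].

Definition depth (R : comNzRingType) (m : set R) (M : lmodType R) (t : nat) :
    Prop :=
  (exists2 s : seq R, size s = t & regular_sequence m M s) /\
  forall s : seq R, regular_sequence m M s -> (size s <= t)%N.

Definition cohen_macaulay (R : comNzRingType) (m : set R) : Prop :=
  exists d, krull_dim R d /\ depth m R^o d.

Definition maximal_cohen_macaulay (R : comNzRingType) (m : set R)
    (M : lmodType R) : Prop :=
  fin_gen M /\ exists d, krull_dim R d /\ depth m M d.

Definition residue_module (R : comNzRingType) (m : set R) (k : lmodType R) :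
    Prop :=
  exists pi : {linear R^o -> k},
    (forall y, exists x, pi x = y) /\ forall x, pi x = 0 <-> m x.

(* The type of M is dim_k Ext^t(k, M) with t = depth M; the dimension over
   k = R/m is the length over R. *)
Definition cm_type (R : comNzRingType) (m : set R) (M : lmodType R) (r : nat) :
    Prop :=
  exists (t : nat) (k : lmodType R) (F : projective_resolution k),
    [/\ depth m M t, residue_module m k &
        subquotient_length (ext_coboundaries M F t) (ext_cocycles M F t) r].

Definition finite_injective_dim (R : comNzRingType) (M : lmodType R) : Prop :=
  exists (E : nat -> lmodType R) (d : forall i, {linear E i -> E i.+1})
         (eta : {linear M -> E 0%N}) (n : nat),
    [/\ forall i, injective_module (E i),
        injective eta,
        forall x, d 0%N x = 0 <-> exists y, eta y = x,
        forall i x, d i.+1 x = 0 <-> exists y, d i y = x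
      & forall i (x : E i), (n < i)%N -> x = 0].

Definition canonical_module (R : comNzRingType) (m : set R) (w : lmodType R) :
    Prop :=
  [/\ maximal_cohen_macaulay m w, cm_type m w 1 & finite_injective_dim w].

Definition almost_gorenstein (R : comNzRingType) (m : set R) : Prop :=
  cohen_macaulay m /\
  exists w : lmodType R, canonical_module m w /\
  exists (C : lmodType R) (f : {linear R^o -> w}) (g : {linear w -> C}),
    [/\ fin_gen C, injective f,
        forall y, g y = 0 <-> exists x, f x = y,
        forall z, exists y, g y = z
      & exists2 e : nat, multiplicity m C e & min_number_gens C e].

(* Main.v *)
(* Write w for the canonical module, u in w for the image of 1 and x for a
   regular element of the maximal ideal m.  R is reduced since it embeds in its
   completion.

   ca(R) <= co(R).  Since w has type 1, lengths show that w / Ru is killed by a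
   power of x; hence w / Ru has dimension 0, its multiplicity is its length, and
   the equality with the number of generators gives m w <= R u.  Let K <= m R^p
   be the first syzygy of a submodule M of R^n for a minimal set of generators.
   As Ext^1(M, w) = 0, every functional K -> R u extends to R^p -> w, that is,
   it is the scalar product with a vector of w; and w K makes sense inside R^p
   because m w <= R u.  So if r id_K factors through a free module, then so does
   r id_M.  An element r of ca(R) has the former property for the high syzygies
   of every ideal, hence for the ideal s R[x] <= R, for x integral and s a
   suitable denominator; this forces r x in R.

   co(R) <= ca(R).  A unit relation between the l + 1 products a^i b^(l - i),
   where l is the length of R / x, makes every element of Q(R) a root of a
   polynomial over R with a coefficient 1.  By Seidenberg's argument the integral
   closure S of R is then a Pruefer ring: for every matrix A over Q(R) there is
   B with A B A = A and A B over S.  If r S <= R this shows that r id_M factors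
   through a free module for every finitely generated submodule M of R^n, and
   such M include all first syzygies; so r kills Ext^i for i >= 2.  No finiteness
   of S over R is needed. *)

Require Import Defs.
From HB Require Import structures.
From mathcomp Require Import all_boot all_order all_algebra.
From mathcomp Require Import boolp classical_sets functions.
From mathcomp Require Import ring.

Set Implicit Arguments.
Unset Strict Implicit.
Unset Printing Implicit Defensive.

Import GRing.Theory.

Local Open Scope classical_set_scope.
Local Open Scope ring_scope.

(** * Submodules and linear combinations *)

Section Submodules.
Variables (R : comNzRingType) (M : lmodType R).
Implicit Types S : set M.

Lemma submoduleD S x y : submodule S -> S x -> S y -> S (x + y).
Proof. by move=> [_ SD] Sx Sy; rewrite -[x]scale1r; apply: SD. Qed.

Lemma submoduleZ S a x : submodule S -> S x -> S (a *: x).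
Proof. by move=> [S0 SD] Sx; rewrite -[_ *: _]addr0; apply: SD. Qed.

Lemma submoduleB S x y : submodule S -> S x -> S y -> S (x - y).
Proof. by move=> hS Sx Sy; rewrite addrC -scaleN1r; apply: hS.2. Qed.

Lemma submodule_sum S (I : Type) (r : seq I) (P : pred I) (F : I -> M) :
  submodule S -> (forall i, P i -> S (F i)) -> S (\sum_(i <- r | P i) F i).
Proof.
move=> hS SF; elim/big_ind: _ => //; first exact: hS.1.
by move=> x y; apply: submoduleD.
Qed.

Lemma submodule_span_submodule (A : set M) : submodule (submodule_span A).
Proof.
split; first by exists 0%N, (fun=> 0), (fun=> 0); split; [case|rewrite big_ord0].
move=> a _ _ [n [c [x [Ax ->]]]] [k [d [y [Ay ->]]]].
exists (n + k)%N.
exists (fun i => match fintype.split i with inl j => a * c j | inr j => d j end).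
exists (fun i => match fintype.split i with inl j => x j | inr j => y j end).
split; first by move=> i; case: (fintype.split i).
rewrite big_split_ord /= scaler_sumr; congr (_ + _); apply: eq_bigr => i _.
  by rewrite -[lshift _ _]/(unsplit (inl i)) unsplitK scalerA.
by rewrite -[rshift _ _]/(unsplit (inr i)) unsplitK.
Qed.

Lemma sub_submodule_span (A : set M) : A `<=` submodule_span A.
Proof.
move=> x Ax; exists 1%N, (fun=> 1), (fun=> x).
by rewrite big_ord1 scale1r.
Qed.

Lemma submodule_span_min (A S : set M) :
  submodule S -> A `<=` S -> submodule_span A `<=` S.
Proof.
move=> hS AS _ [n [c [x [Ax ->]]]]; apply: submodule_sum => // i _.
by apply: submoduleZ => //; apply/AS/Ax.
Qed.

Lemma sum_delta_scale (p : nat) (g : 'I_p -> M) i :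
  \sum_j (delta_mx 0 i : 'rV[R]_p) 0 j *: g j = g i.
Proof.
rewrite (bigD1 i) //= mxE !eqxx scale1r big1 ?addr0 // => j ne_j.
by rewrite mxE (negbTE ne_j) andbF scale0r.
Qed.

Lemma submodule_lincomb (p : nat) (g : 'I_p -> M) :
  submodule [set y | exists v : 'rV[R]_p, y = \sum_i v 0 i *: g i].
Proof.
split; first by exists 0; rewrite big1 // => i _; rewrite mxE scale0r.
move=> a _ _ [v ->] [w ->]; exists (a *: v + w).
rewrite scaler_sumr -big_split /=; apply: eq_bigr => i _.
by rewrite !mxE scalerDl scalerA.
Qed.

Lemma submodule_span_seqP (s : seq M) y :
  submodule_span [set x | x \in s] y <->
  exists v : 'rV[R]_(size s), y = \sum_i v 0 i *: s`_i.
Proof.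
split.
  apply: (submodule_span_min (submodule_lincomb _)) => x /= xs.
  have lt_xs : (index x s < size s)%N by rewrite index_mem.
  exists (delta_mx 0 (Ordinal lt_xs)).
  rewrite (bigD1 (Ordinal lt_xs)) //= mxE !eqxx scale1r nth_index // big1 ?addr0 //.
  by move=> i ne_i; rewrite mxE (negbTE ne_i) andbF scale0r.
move=> [v ->]; exists (size s), (fun i => v 0 i), (fun i => s`_i).
by split=> // i; apply: mem_nth.
Qed.

Lemma fin_genP : fin_gen M ->
  exists (p : nat) (g : 'I_p -> M),
    forall y, exists v : 'rV[R]_p, y = \sum_i v 0 i *: g i.
Proof.
move=> [s sM]; exists (size s), (fun i => s`_i) => y.
by apply/submodule_span_seqP; rewrite sM.
Qed.

Lemma fin_gen_lincomb (p : nat) (g : 'I_p -> M) :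
  (forall y, exists v : 'rV[R]_p, y = \sum_i v 0 i *: g i) -> fin_gen M.
Proof.
move=> gM; exists (codom g); apply/seteqP; split=> // y _.
have [v ->] := gM y; apply: submodule_sum; first exact: submodule_span_submodule.
move=> i _; apply: submoduleZ; first exact: submodule_span_submodule.
by apply: sub_submodule_span => /=; apply: codom_f.
Qed.

End Submodules.

(** * Ideals, sums [I + R a] and colon ideals *)

Section Ideals.
Variable R : comNzRingType.
Implicit Types I J : set R.

Lemma idealD I (x y : R) : ideal I -> I x -> I y -> I (x + y).
Proof. exact: (@submoduleD R R^o). Qed.

Lemma idealMl I (a x : R) : ideal I -> I x -> I (a * x).
Proof. exact: (@submoduleZ R R^o). Qed.

Lemma idealMr I (a x : R) : ideal I -> I x -> I (x * a).
Proof. by rewrite mulrC; apply: idealMl. Qed.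

Lemma idealB I (x y : R) : ideal I -> I x -> I y -> I (x - y).
Proof. exact: (@submoduleB R R^o). Qed.

Lemma idealN I (x : R) : ideal I -> I x -> I (- x).
Proof. by move=> hI Ix; rewrite -mulN1r; apply: idealMl. Qed.

Lemma ideal0 I : ideal I -> I 0.
Proof. by case. Qed.

Lemma ideal1 I (x : R) : ideal I -> I 1 -> I x.
Proof. by move=> hI I1; rewrite -[x]mulr1; apply: idealMl. Qed.

Lemma ideal_sum I (T : Type) (r : seq T) (P : pred T) (F : T -> R) :
  ideal I -> (forall i, P i -> I (F i)) -> I (\sum_(i <- r | P i) F i).
Proof. exact: (@submodule_sum R R^o). Qed.

Lemma idealP I : I 0 -> (forall x y, I x -> I y -> I (x + y)) ->
  (forall a x, I x -> I (a * x)) -> ideal I.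
Proof. by move=> I0 ID IM; split=> // a x y Ix Iy; apply/ID/Iy/IM. Qed.

Lemma sum_delta_mul (p : nat) (g : 'I_p -> R) i :
  \sum_j (delta_mx 0 i : 'rV[R]_p) 0 j * g j = g i.
Proof. exact: (@sum_delta_scale R R^o). Qed.

Lemma ideal_principal (a : R) : ideal [set x | exists y, x = y * a].
Proof.
apply: idealP => [|_ _ [y ->] [z ->]|b _ [y ->]].
- by exists 0; rewrite mul0r.
- by exists (y + z); rewrite mulrDl.
- by exists (b * y); rewrite mulrA.
Qed.

Definition ideal_adjoin I a : set R := [set x | exists y, I (x - y * a)].

Lemma ideal_adjoin_ideal I a : ideal I -> ideal (ideal_adjoin I a).
Proof.
move=> hI; apply: idealP => [|x y [z Iz] [w Iw]|b x [y Iy]].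
- by exists 0; rewrite mul0r subrr; apply: ideal0.
- exists (z + w); have -> : x + y - (z + w) * a = x - z * a + (y - w * a) by ring.
  exact: idealD.
- exists (b * y); have -> : b * x - b * y * a = b * (x - y * a) by ring.
  exact: idealMl.
Qed.

Lemma sub_ideal_adjoin I a : I `<=` ideal_adjoin I a.
Proof. by move=> x Ix; exists 0; rewrite mul0r subr0. Qed.

Lemma mem_ideal_adjoin I a : ideal I -> ideal_adjoin I a a.
Proof. by move=> hI; exists 1; rewrite mul1r subrr; apply: ideal0. Qed.

Definition colon I a : set R := [set x | I (x * a)].

Lemma colon_ideal I a : ideal I -> ideal (colon I a).
Proof.
move=> hI; apply: idealP => [|x y Ix Iy|b x Ix]; rewrite /colon /=.
- by rewrite mul0r; apply: ideal0.
- by rewrite mulrDl; apply: idealD.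
- by rewrite -mulrA; apply: idealMl.
Qed.

End Ideals.

(** * Consequences of the noetherian condition *)

Section Noetherian.
Variables (R : comNzRingType) (R_noetherian : noetherian R).

Lemma noetherian_fg (I : set R) : ideal I ->
  exists (p : nat) (g : 'I_p -> R),
    forall x, I x <-> exists v : 'rV[R]_p, x = \sum_i v 0 i * g i.
Proof.
move=> /R_noetherian [s ->]; exists (size s), (fun i => s`_i) => x.
exact: (@submodule_span_seqP R R^o).
Qed.

Lemma noetherian_acc (f : nat -> set R) : (forall n, ideal (f n)) ->
  (forall n, f n `<=` f n.+1) -> exists n, f n.+1 `<=` f n.
Proof.
move=> f_ideal f_incr.
have f_mono n k : (n <= k)%N -> f n `<=` f k.
  elim: k => [|k IHk]; first by rewrite leqn0 => /eqP ->.
  rewrite leq_eqVlt ltnS => /orP[/eqP -> //|/IHk nk].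
  exact: subset_trans nk (f_incr k).
have U_ideal : ideal [set x | exists n, f n x].
  apply: idealP => [|x y [n fx] [k fy]|a x [n fx]].
  - by exists 0%N; apply: ideal0.
  - exists (maxn n k); apply: idealD => //.
      exact: f_mono (leq_maxl _ _) _ fx.
    exact: f_mono (leq_maxr _ _) _ fy.
  - by exists n; apply: idealMl.
have [p [g gU]] := noetherian_fg U_ideal.
have /choice [h hg] : forall i, exists n, f n (g i).
  move=> i; apply/gU; exists (delta_mx 0 i).
  by rewrite sum_delta_mul.
exists (\max_i h i)%N => x fx; have /gU [v ->] : exists n, f n x by exists (\max_i h i).+1.
apply: ideal_sum => // i _; apply: idealMl => //.
exact: f_mono (leq_bigmax i) _ (hg i).
Qed.

(** A failure of P at I would yield, by choosing a larger failure again and again, a strictly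
    increasing sequence of ideals. *)
Lemma noetherian_ind (P : set R -> Prop) :
  (forall I, ideal I -> (forall J, ideal J -> I `<=` J -> ~ J `<=` I -> P J) -> P I) ->
  forall I, ideal I -> P I.
Proof.
move=> Pstep I hI; apply: contrapT => nPI.
pose T := {J : set R | ideal J /\ ~ P J}.
have /choice [next nextP] : forall J : T, exists K : T,
    sval J `<=` sval K /\ ~ sval K `<=` sval J.
  move=> [J [hJ nPJ]] /=; apply: contrapT => no_K; apply: nPJ; apply: Pstep => // K hK JK nKJ.
  by apply: contrapT => nPK; apply: no_K; exists (exist _ K (conj hK nPK)).
pose f n := sval (iter n next (exist _ I (conj hI nPI))).
have [n] : exists n, f n.+1 `<=` f n.
  apply: noetherian_acc => n; last by case: (nextP (iter n next (exist _ I (conj hI nPI)))).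
  by rewrite /f; case: (iter _ _ _) => J [].
by case: (nextP (iter n next (exist _ I (conj hI nPI)))).
Qed.

Lemma noetherian_max (P : set R -> Prop) (I : set R) : ideal I -> P I ->
  exists J, [/\ ideal J, P J, I `<=` J &
    forall K, ideal K -> P K -> J `<=` K -> K `<=` J].
Proof.
move=> hI; elim/noetherian_ind: I / hI => I hI IH PI.
have [[K [hK PK IK nKI]]|no_K] := pselect (exists K, [/\ ideal K, P K, I `<=` K & ~ K `<=` I]).
  have [J [hJ PJ KJ Jmax]] := IH K hK IK nKI PK.
  by exists J; split=> //; apply: subset_trans IK KJ.
exists I; split=> // K hK PK IK; apply: contrapT => nKI.
by apply: no_K; exists K.
Qed.

(** A maximal element among the [colon I a] with a outside I is prime: if it contains x y but not y,
    then [colon I (y * a)] contains both it and x, and maximality applies. *)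
Lemma associated_prime (I : set R) : ideal I -> ~ I 1 ->
  exists2 a, ~ I a & prime_ideal (colon I a).
Proof.
move=> hI nI1.
have [||J [hJ [a nIa defJ] IJ Jmax]] :=
    @noetherian_max (fun J => exists2 a, ~ I a & J = colon I a) (colon I 1).
  exact: colon_ideal.
  by exists 1.
exists a => //; rewrite -defJ; split=> //.
  by rewrite defJ /colon /= mul1r.
move=> x y Jxy; have [Jy|nJy] := pselect (J y); [by right|left].
apply: (Jmax (colon I (y * a))).
- exact: colon_ideal.
- by exists (y * a) => //; rewrite defJ in nJy.
- by move=> z; rewrite defJ /colon /= => Iz; rewrite mulrCA; apply: idealMl.
- by rewrite /colon /= mulrA; move: Jxy; rewrite defJ.
Qed.

(** Induction on n: lift generators of the ideal of first coordinates, and add generators of the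
    part of S with first coordinate 0. *)
Lemma noetherian_rV (n : nat) (S : set 'rV[R]_n) : submodule S ->
  exists (p : nat) (A : 'M[R]_(p, n)), forall y, S y <-> exists v, y = v *m A.
Proof.
elim: n S => [|n IHn] S hS.
  exists 0%N, 0 => y; rewrite (thinmx0 y); split=> _; last exact: hS.1.
  by exists 0; rewrite mulmx0.
pose S1 : set 'rV_(1 + n) := S.
pose I : set R := [set a | exists w : 'rV_n, S1 (row_mx a%:M w)].
have hI : ideal I.
  split; first by exists 0; rewrite raddf0 row_mx0; apply: hS.1.
  move=> a x y [v Sv] [w Sw]; exists (a *: v + w).
  have -> : row_mx (a *: (x : R^o) + y)%:M (a *: v + w) =
      a *: row_mx x%:M v + row_mx y%:M w :> 'rV_(1 + n).
    by rewrite scale_row_mx add_row_mx scale_scalar_mx raddfD.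
  exact: hS.2.
have [p [g gI]] := noetherian_fg hI.
have /choice [w wg] : forall i, exists w : 'rV_n, S1 (row_mx (g i)%:M w).
  move=> i; rewrite -[exists _, _]/(I (g i)); apply/gI; exists (delta_mx 0 i).
  by rewrite sum_delta_mul.
pose S' : set 'rV_n := [set y | S1 (row_mx 0 y)].
have hS' : submodule S'.
  split; first by rewrite /S' /= row_mx0; apply: hS.1.
  move=> a x y Sx Sy; rewrite /S' /=.
  have -> : row_mx 0 (a *: x + y) = a *: row_mx 0 x + row_mx 0 y :> 'rV_(1 + n).
    by rewrite scale_row_mx add_row_mx scaler0 addr0.
  exact: hS.2.
have [q [A AS']] := IHn _ hS'.
pose G : 'M_(p, 1 + n) := \matrix_i row_mx (g i)%:M (w i).
have GS v : S1 (v *m G).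
  rewrite mulmx_sum_row; apply: submodule_sum => // i _; apply: submoduleZ => //.
  by rewrite rowK; apply: wg.
have AS v : S1 (v *m row_mx (0 : 'M_(q, 1)) A).
  by rewrite mul_mx_row mulmx0 -/(S' _); apply/AS'; exists v.
exists (p + q)%N, (col_mx G (row_mx 0 A)) => y; split=> [Sy|[v ->]]; last first.
  by rewrite -[v]hsubmxK mul_row_col; exact: (@submoduleD _ _ S1 _ _ hS (GS _) (AS _)).
pose y1 : 'rV_(1 + n) := y; pose a := lsubmx y1 0 0.
have def_y : y1 = row_mx a%:M (rsubmx y1) by rewrite -mx11_scalar hsubmxK.
have [|v def_v] := (gI a).1; first by exists (rsubmx y1); rewrite -def_y.
pose z : 'rV_(1 + n) := y1 - v *m G.
have Sz : S1 z by apply: submoduleB.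
have z0 : lsubmx z = 0.
  have zE : z = row_mx a%:M (rsubmx y1) - v *m row_mx (\col_i g i) (\matrix_i w i).
    rewrite -def_y; congr (_ - v *m _); apply/row_matrixP => i.
    rewrite row_row_mx !rowK; congr row_mx.
    by apply/rowP=> j; rewrite !mxE !(ord1 j) eqxx.
  rewrite zE mul_mx_row opp_row_mx add_row_mx row_mxKl.
  apply/rowP=> i; rewrite !mxE !(ord1 i) eqxx mulr1n def_v; apply/eqP; rewrite subr_eq0.
  by apply/eqP/eq_bigr => j _; rewrite mxE.
have /AS' [u def_u] : S' (rsubmx z) by rewrite /S' /= -z0 hsubmxK.
have def_z : z = u *m row_mx (0 : 'M_(q, 1)) A.
  by rewrite mul_mx_row mulmx0 -def_u -z0 hsubmxK.
by exists (row_mx v u); rewrite mul_row_col -[u *m _]def_z /z addrC subrK.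
Qed.

End Noetherian.
Lemma lreg_eq0P (R : comNzRingType) (x : R) :
  GRing.lreg x <-> forall y, x * y = 0 -> y = 0.
Proof.
split=> [x_reg y xy0|x_reg y z /eqP]; first by apply: x_reg; rewrite mulr0.
by rewrite -subr_eq0 -mulrBr => /eqP/x_reg/eqP; rewrite subr_eq0 => /eqP.
Qed.

(** * Lengths of chains relative to a filtration *)

Section ChainBound.
Variables (R : comNzRingType) (M : lmodType R) (H : nat -> set M) (L : nat).
(* Every quotient H k / H k.+1 is simple or zero. *)
Hypothesis H_simple : forall k, (k < L)%N -> forall w w', H k w -> H k w' ->
  ~ H k.+1 w -> exists r, H k.+1 (w' - r *: w).

(** The indices of the factors [H k / H k.+1] in which the part of X inside [H k] has a nonzero
    image. Its cardinal stands in for a length. *)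
Let jumps (X : set M) : {set 'I_L} :=
  [set k : 'I_L | `[< exists v, [/\ X v, H k v & ~ H k.+1 v] >]].

Let jumps_mono (X Y : set M) : X `<=` Y -> jumps X \subset jumps Y.
Proof.
move=> XY; apply/fintype.subsetP => k; rewrite inE => /asboolP [v [Xv Hv nHv]].
rewrite inE; apply/asboolP; exists v; split=> //; exact: XY.
Qed.

(** Successive approximation: an error in [H k] is moved into [H k.+1] by an element of X, since X
    meets the same simple factors as Y. At k = L the error lies in X. *)
Let jumps_inj (X Y : set M) : submodule X -> submodule Y ->
  H L `<=` X -> Y `<=` H 0 -> X `<=` Y -> jumps X = jumps Y -> Y `<=` X.
Proof.
move=> hX hY HX YH XY eqJ y Yy.
suff: exists2 x, X x & H L (y - x).
  by move=> [x Xx /HX]; rewrite -{2}[y](subrK x) => /submoduleD; apply.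
suff: forall k, (k <= L)%N -> exists2 x, X x & H k (y - x) by apply.
elim=> [_|k IHk lt_kL]; first by exists 0; [exact: hX.1|rewrite subr0; apply: YH].
have [x Xx Hx] := IHk (ltnW lt_kL).
have [Hx1|nHx1] := pselect (H k.+1 (y - x)); first by exists x.
have : Ordinal lt_kL \in jumps X.
  rewrite eqJ inE; apply/asboolP; exists (y - x); split=> //.
  by apply: submoduleB => //; apply: XY.
rewrite inE => /asboolP [v [Xv Hv nHv]].
have [r Hr] := H_simple lt_kL Hv Hx nHv; exists (x + r *: v).
  by apply: submoduleD => //; apply: submoduleZ.
by rewrite opprD addrA.
Qed.

(** By [jumps_inj] the sets [jumps (c i)] grow strictly, inside a set of L elements. *)
Lemma chain_bound (l : nat) (c : nat -> set M) :
  (forall i, (i <= l)%N -> [/\ submodule (c i), H L `<=` c i & c i `<=` H 0]) ->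
  (forall i, (i < l)%N -> c i `<=` c i.+1 /\ ~ c i.+1 `<=` c i) ->
  (l <= L)%N.
Proof.
move=> c_in c_strict.
suff: (l <= #|jumps (c l)|)%N by move/leq_trans; apply; rewrite -[X in (_ <= X)%N]card_ord max_card.
suff: forall i, (i <= l)%N -> (i <= #|jumps (c i)|)%N by apply.
elim=> // i IHi lt_il; apply: leq_ltn_trans (IHi (ltnW lt_il)) _.
have [ci ci1] := c_strict _ lt_il; apply/proper_card; rewrite properE jumps_mono //=.
apply/negP => sJ; apply: ci1.
have eqJ : jumps (c i) = jumps (c i.+1) by apply/eqP; rewrite finset.eqEsubset jumps_mono.
have [hX HX _] := c_in i (ltnW lt_il); have [hY _ YH] := c_in i.+1 lt_il.
exact: jumps_inj.
Qed.

End ChainBound.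

(** * Local rings: Nakayama, minimal generators, composition series *)

Section Local.
Variables (R : comNzRingType) (m : set R).
Hypotheses (R_noetherian : noetherian R) (R_local : local_ring m).

Lemma local_ideal : ideal m.
Proof. by case: R_local => [[]]. Qed.
Let hm := local_ideal.

Lemma local_not1 : ~ m 1.
Proof. by case: R_local => [[]]. Qed.

Lemma local_proper (I : set R) : ideal I -> ~ I 1 -> I `<=` m.
Proof.
move=> hI nI1.
have [J [hJ nJ1 IJ Jmax]] := noetherian_max R_noetherian (P := fun J => ~ J 1) hI nI1.
suff <- : J = m by [].
apply: R_local.2; split=> // K hK JK nK1.
by apply/seteqP; split=> //; apply: Jmax.
Qed.

Lemma local_unit (a : R) : ~ m a -> exists b : R, b * a = 1.
Proof.
move=> nma; apply: contrapT => nunit; apply: nma.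
apply: (local_proper (ideal_principal a)); last by exists 1; rewrite mul1r.
by move=> [b def1]; apply: nunit; exists b.
Qed.

Lemma local_unit_1B (a : R) : m a -> exists b : R, b * (1 - a) = 1.
Proof.
move=> ma; apply: local_unit => m1a; apply: local_not1.
by rewrite -(subrK a 1); apply: idealD.
Qed.

Lemma local_prime : prime_ideal m.
Proof.
split=> //; first exact: local_not1.
move=> x y mxy; have [|/local_unit [b bx]] := pselect (m x); first by left.
by right; rewrite -[y]mul1r -bx -mulrA; apply: idealMl.
Qed.

Lemma prime_sub_local p : prime_ideal p -> p `<=` m.
Proof. by case=> hp np1 _; apply: local_proper. Qed.

Section Modules.
Variable M : lmodType R.

(** Elimination: [1 - A ord_max ord_max] is a unit, so the last relation expresses the last
    generator modulo U, and substitution leaves a system of the same shape with one generator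
    fewer. *)
Lemma nakayama (U : set M) (p : nat) (g : 'I_p -> M) (A : 'I_p -> 'I_p -> R) :
  submodule U -> (forall i j, m (A i j)) ->
  (forall i, U (g i - \sum_j A i j *: g j)) -> forall i, U (g i).
Proof.
move=> hU; elim: p g A => [g A _ _ []//|p IHp g A mA Ug].
have [b b1] := local_unit_1B (mA ord_max ord_max).
pose w := widen_ord (leqnSn p).
have Umax : U (g ord_max - \sum_(j < p) (b * A ord_max (w j)) *: g (w j)).
  have := submoduleZ b hU (Ug ord_max); rewrite big_ord_recr /=.
  rewrite opprD addrA addrAC -{1}[g ord_max]scale1r -scalerBl scalerBr scalerA b1 scale1r.
  rewrite scaler_sumr.
  by under [in X in U X -> _]eq_bigr => j _ do rewrite scalerA.
have Uw j : U (g (w j)).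
  apply: (IHp (g \o w)
    (fun i j => A (w i) (w j) + A (w i) ord_max * (b * A ord_max (w j)))).
    by move=> i k; apply: idealD => //; apply: idealMr.
  move=> i /=; have := submoduleD hU (Ug (w i)) (submoduleZ (A (w i) ord_max) hU Umax).
  rewrite big_ord_recr /= scalerBr opprD addrA addrA subrK scaler_sumr -addrA -opprD -big_split /=.
  by under [in X in U X -> _]eq_bigr => k _ do rewrite scalerA -scalerDl.
move=> i; have [j ->|->] := unliftP ord_max i.
  by rewrite [lift _ _](_ : _ = w j) //; apply/val_inj; rewrite /= /bump leqNgt ltn_ord.
rewrite -[g _](subrK (\sum_(j < p) (b * A ord_max (w j)) *: g (w j))).
by apply: submoduleD => //; apply: submodule_sum => // j _; apply: submoduleZ.
Qed.

(** As long as some relation has a coefficient outside m, hence a unit, the corresponding generator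
    can be discarded. *)
Lemma minimal_lincomb (p : nat) (g : 'I_p -> M) :
  exists (q : nat) (h : 'I_q -> M),
    (forall y, (exists v : 'rV[R]_p, y = \sum_i v 0 i *: g i) <->
               (exists v : 'rV[R]_q, y = \sum_i v 0 i *: h i)) /\
    (forall v : 'rV[R]_q, \sum_i v 0 i *: h i = 0 -> forall i, m (v 0 i)).
Proof.
elim: p g => [|p IHp] g; first by exists 0%N, g; split=> // v _ [].
have [mg|] := pselect (forall v : 'rV[R]_p.+1, \sum_i v 0 i *: g i = 0 -> forall i, m (v 0 i)).
  by exists p.+1, g.
move=> /existsNP [v /not_implyP [vg /existsNP [i /local_unit [b bv]]]].
have [q [h [gh mh]]] := IHp (g \o lift i); exists q, h; split=> // y; rewrite -gh.
have gi : g i = - \sum_j (b * v 0 (lift i j)) *: g (lift i j).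
  move/(congr1 (fun y => b *: y)): vg; rewrite (bigD1_ord i) //= scalerDr scalerA bv scale1r scaler0.
  move/eqP; rewrite addr_eq0 => /eqP ->; rewrite scaler_sumr.
  by congr (- _); apply: eq_bigr => j _; rewrite scalerA.
split=> [[w ->]|[w ->]].
  exists (\row_j (w 0 (lift i j) - w 0 i * (b * v 0 (lift i j)))).
  rewrite (bigD1_ord i) //= gi scalerN addrC scaler_sumr -sumrB.
  by apply: eq_bigr => j _; rewrite mxE scalerBl scalerA.
exists (\row_j if unlift i j is Some k then w 0 k else 0).
rewrite [RHS](bigD1_ord i) //= mxE unlift_none scale0r add0r.
by apply: eq_bigr => j _; rewrite mxE liftK.
Qed.

End Modules.

Hypothesis R_dim1 : krull_dim R 1.

(** In dimension 1 such a p is a minimal prime, and a reduced ring localised at a minimal prime is a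
    field, where y becomes 0. *)
Lemma prime_zero_divisor (p : set R) y : reduced R ->
  prime_ideal p -> p <> m -> p y -> exists2 s, ~ p s & y * s = 0.
Proof.
move=> R_red p_prime p_m py; apply: contrapT => y_reg.
have [hp np1 pM] := p_prime.
(* If no s outside p kills y, the multiplicative set T avoids 0, because R is reduced. An ideal J
   maximal among those disjoint from T is prime, and J < p < m is too long a chain. *)
pose T z := exists i s, ~ p s /\ z = y ^+ i * s.
have h0 : ideal [set 0 : R].
  by apply: idealP => [|_ _ -> ->|a _ ->]; rewrite /= ?addr0 ?mulr0.
have [|J [hJ JT _ Jmax]] :=
    noetherian_max R_noetherian (P := fun J => forall z, J z -> ~ T z) h0.
  move=> _ -> [i [s [ps def0]]]; case: i def0 => [|i] def0.
    by apply: ps; rewrite -[s]mul1r -(expr0 y) -def0; apply: ideal0.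
  apply: y_reg; exists s => //; apply: (R_red _ i.+1).
  by rewrite exprMn [in X in _ * X]exprS mulrA -def0 mul0r.
have T_mul z w : T z -> T w -> T (z * w).
  move=> [i [s [ps ->]]] [j [t [pt ->]]]; exists (i + j)%N, (s * t); split.
    by move=> /pM [].
  by rewrite exprD; ring.
have J_adjoin a : ~ J a -> exists z b, T z /\ J (z - b * a).
  move=> nJa; apply: contrapT => no_z; apply: nJa.
  apply: (Jmax (ideal_adjoin J a)).
  - exact: ideal_adjoin_ideal.
  - by move=> z [b Jz] Tz; apply: no_z; exists z, b.
  - exact: sub_ideal_adjoin.
  - exact: mem_ideal_adjoin.
have J_prime : prime_ideal J.
  split=> //.
    by move=> /JT; apply; exists 0%N, 1; split=> //; rewrite mulr1.
  move=> a b Jab; apply: contrapT => /not_orP [/J_adjoin [z [c [Tz Jz]]]].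
  move=> /J_adjoin [w [d [Tw Jw]]]; apply: (JT (z * w)); last exact: T_mul.
  have -> : z * w = (z - c * a) * w + (c * a) * (w - d * b) + (c * d) * (a * b) by ring.
  apply: idealD; [by []|apply: idealD; [by []|exact: idealMr|exact: idealMl]|exact: idealMl].
have Jp : J `<=` p.
  move=> z Jz; apply: contrapT => pz; apply: (JT z Jz).
  by exists 0%N, z; rewrite mul1r.
have nJy : ~ J y.
  by move=> /JT; apply; exists 1%N, 1; rewrite mulr1.
pose c n := if n is n'.+1 then if n' is 0%N then p else m else J.
have : (2 <= 1)%N; last by [].
apply: (R_dim1.2 2%N c); split=> [[|[|[|]]]|[|[|]]] //= _.
  - exact: local_prime.
  - by split=> // eqJ; apply: nJy; rewrite eqJ.
  - by split=> //; apply: prime_sub_local.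
Qed.

Lemma prime_regular (p : set R) x : reduced R ->
  prime_ideal p -> p x -> GRing.lreg x -> p = m.
Proof.
move=> R_red p_prime px /lreg_eq0P x_reg; apply: contrapT => p_m.
have [s ps /x_reg s0] := prime_zero_divisor R_red p_prime p_m px.
by apply: ps; rewrite s0; apply: ideal0; case: p_prime.
Qed.

(** A composition series of R / J, from J up to R. Each factor is generated by one nonzero class
    killed by m, so it is a copy of R / m. *)
Definition composition_series (J : set R) (L : nat) (c : nat -> set R) : Prop :=
  [/\ c 0%N = J, c L = setT, forall k, ideal (c k) &
      forall k, (k < L)%N -> c k `<=` c k.+1 /\
        exists a, [/\ c k.+1 a, ~ c k a,
          forall y, c k.+1 y -> exists r, c k (y - r * a) &
          forall y, m y -> c k (y * a)]].

(** An associated prime [colon J a] of R / J contains the regular element x, hence is m. So J + R a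
    is the next term, and noetherian induction continues from there. *)
Lemma composition_seriesP (J : set R) x : reduced R -> ideal J -> J x -> GRing.lreg x ->
  exists L c, composition_series J L c.
Proof.
move=> R_red hJ; elim/(noetherian_ind R_noetherian): J / hJ => J hJ IH Jx x_reg.
have [J1|nJ1] := pselect (J 1).
  have JT : J = setT by apply/seteqP; split=> // y _; apply: ideal1.
  by exists 0%N, (fun=> J).
have [a nJa a_prime] := associated_prime R_noetherian hJ nJ1.
have am : colon J a = m.
  by apply: prime_regular x_reg => //; exact: idealMr.
have [|||L [c [c0 cL c_ideal c_step]]] := IH (ideal_adjoin J a) (ideal_adjoin_ideal a hJ)
    (@sub_ideal_adjoin _ J a).
- by move=> /(_ a (mem_ideal_adjoin a hJ)).
- exact: sub_ideal_adjoin.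
- exact: x_reg.
exists L.+1, (fun k => if k is k'.+1 then c k' else J); split=> // [[]//|[_|k lt_kL]].
  rewrite c0; split; first exact: sub_ideal_adjoin.
  exists a; split=> //; first exact: mem_ideal_adjoin.
  by move=> y my; rewrite -[J _]/(colon J a y) am.
exact: c_step.
Qed.

(* Let J be the ideal generated by g.  If no such relation exists, then
   J / x J has length > l = length (R / x); but R / x J has length
   length (R / J) + l, because x R / x J is isomorphic to R / J. *)
Lemma unit_relation (x : R) (l : nat) (c : nat -> set R) :
  reduced R -> m x -> GRing.lreg x ->
  composition_series [set y | exists z, y = z * x] l c ->
  forall g : 'I_l.+1 -> R, (exists i, GRing.lreg (g i)) ->
  exists (v : 'rV[R]_l.+1) (i : 'I_l.+1), v 0 i = 1 /\ \sum_j v 0 j * g j = 0.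
Proof.
move=> R_red mx x_reg [c0 cl c_ideal c_step] g [i0 g_reg].
pose J : set R := [set y | exists v : 'rV[R]_l.+1, y = \sum_j v 0 j * g j].
have hJ : ideal J := @submodule_lincomb R R^o _ g.
have Jg i : J (g i).
  by exists (delta_mx 0 i); rewrite sum_delta_mul.
have [t [e [e0 et e_ideal e_step]]] := composition_seriesP R_red hJ (Jg i0) g_reg.
(* H descends from R to x R along c, then from x R to x J along the series e of R / J multiplied by
   x: l + t simple factors in all. *)
pose H k : set R := if (k <= l)%N then c (l - k)%N
  else [set y | exists2 z, e (t - (k - l))%N z & y = z * x].
have xe_ideal k : ideal [set y | exists2 z, e k z & y = z * x].
  apply: idealP => [|_ _ [y ey ->] [z ez ->]|a _ [y ey ->]].
  - by exists 0; rewrite ?mul0r //; apply: ideal0.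
  - by exists (y + z); rewrite ?mulrDl //; apply: idealD.
  - by exists (a * y); rewrite ?mulrA //; apply: idealMl.
have Hl : H l = [set y | exists2 z, e t z & y = z * x].
  rewrite /H leqnn subnn c0 et; apply/seteqP; split=> y [z]; first by exists z.
  by exists z.
(* S rises from m J to J. Without a unit relation each of its l.+1 steps is strict, and e continues
   the chain from J to R. *)
pose S i : set R := [set y | exists v : 'rV[R]_l.+1,
  y = \sum_j v 0 j * g j /\ forall j : 'I_l.+1, (i <= j)%N -> m (v 0 j)].
have S_ideal i : ideal (S i).
  apply: idealP => [|_ _ [v [-> mv]] [w [-> mw]]|a _ [v [-> mv]]].
  - exists 0; split=> [|j _]; last by rewrite mxE; apply: ideal0.
    by rewrite big1 // => j _; rewrite mxE mul0r.
  - exists (v + w); split=> [|j ij]; last by rewrite mxE; apply: idealD; [|apply: mv|apply: mw].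
    by rewrite -big_split; apply: eq_bigr => j _; rewrite mxE mulrDl.
  - exists (a *: v); split=> [|j ij]; last by rewrite mxE; apply: idealMl => //; apply: mv.
    by rewrite mulr_sumr; apply: eq_bigr => j _; rewrite mxE mulrA.
apply: contrapT => no_rel.
pose C i := if (i <= l.+1)%N then S i else e (i - l.+1)%N.
have Sl : S l.+1 = J.
  apply/seteqP; split=> y [v]; first by move=> [-> _]; exists v.
  by move=> ->; exists v; split=> // j; rewrite leqNgt ltn_ord.
suff: (l.+1 + t <= l + t)%N by rewrite leq_add2r ltnn.
apply: (@chain_bound R R^o H (l + t) _ (l.+1 + t) C).
- move=> k lt_k /= w0 w0'; pose w : R := w0; pose w' : R := w0'; rewrite -/w -/w' => Hw Hw' nHw.
  have [lt_kl|le_lk] := ltnP k l.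
    move: Hw Hw' nHw; rewrite /H ltnW // lt_kl.
    have lt1 : (l - k.+1 < l)%N by rewrite ltn_subrL (leq_ltn_trans _ lt_kl).
    have [_ [a [_ _ ca ma]]] := c_step _ lt1.
    rewrite subnSK // in ca * => /ca [r cr] /ca [r' cr'] ncw.
    have [mr|/local_unit [b br]] := pselect (m r).
      case: ncw; rewrite -(subrK (r * a) w); apply: idealD => //; exact: ma.
    exists (r' * b); rewrite -[_ *: _]/((r' * b) * w).
    have -> : w' - (r' * b) * w =
        (w' - r' * a) - (r' * b) * (w - r * a) + r' * a * (1 - b * r).
      by ring.
    by rewrite br subrr mulr0 addr0; apply: idealB => //; apply: idealMl.
  have Hk j : (l <= j)%N -> H j = [set y | exists2 z, e (t - (j - l))%N z & y = z * x].
    rewrite leq_eqVlt => /orP[/eqP <-|lt_lj]; first by rewrite Hl subnn subn0.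
    by rewrite /H leqNgt lt_lj.
  move: Hw Hw' nHw; rewrite !Hk // ?(leqW le_lk) // subSn //.
  move=> [z ez ->] [z' ez' ->] nHz.
  have lt1 : (k - l < t)%N by rewrite ltn_subLR.
  have lt2 : (t - (k - l).+1 < t)%N by rewrite ltn_subrL (leq_ltn_trans _ lt1).
  have [_ [a [_ _ ea ma]]] := e_step _ lt2.
  rewrite subnSK // in ea; have [r er] := ea _ ez; have [r' er'] := ea _ ez'.
  have [mr|/local_unit [b br]] := pselect (m r).
    case: nHz; exists z => //; rewrite -(subrK (r * a) z); apply: idealD => //; exact: ma.
  exists (r' * b), (z' - r' * b * z); last by rewrite mulrBl -[_ *: _]/(_ * _) !mulrA.
  have -> : z' - r' * b * z =
      (z' - r' * a) - (r' * b) * (z - r * a) + r' * a * (1 - b * r) by ring.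
  by rewrite br subrr mulr0 addr0; apply: idealB => //; apply: idealMl.
- have HL : H (l + t)%N `<=` S 0%N.
    rewrite /H; case: leqP => [|lt_l].
      rewrite -{2}[l]addn0 leq_add2l leqn0 => /eqP t0; rewrite t0 addn0 subnn c0.
      move=> _ [y ->]; have : e t y by rewrite et.
      rewrite t0 e0 => -[v ->]; exists (\row_j (v 0 j * x)); split=> [|j _].
        by rewrite mulr_suml; apply: eq_bigr => j _; rewrite mxE; ring.
      by rewrite mxE; apply: idealMl.
    rewrite addKn subnn e0 => _ [_ [v ->] ->]; exists (\row_j (v 0 j * x)); split=> [|j _].
      by rewrite mulr_suml; apply: eq_bigr => j _; rewrite mxE; ring.
    by rewrite mxE; apply: idealMl.
  have S0i i : S 0%N `<=` S i by move=> _ [v [-> mv]]; exists v; split=> // j _; apply: mv.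
  have HJ : H (l + t)%N `<=` J by rewrite -Sl => y /HL /S0i.
  have Je k : (k <= t)%N -> J `<=` e k.
    elim: k => [|k IHk] lt_k; first by rewrite e0.
    by apply: subset_trans (IHk (ltnW lt_k)) _; have [] := e_step _ lt_k.
  move=> i le_i; split.
  + by rewrite /C; case: ifP => _; [exact: S_ideal|exact: e_ideal].
  + rewrite /C; case: (leqP i l.+1) => [_|lt_i]; first exact: subset_trans HL (S0i i).
    by apply: subset_trans HJ (Je _ _); rewrite leq_subLR.
  + by move=> y _; rewrite /H leq0n subn0 cl.
- move=> i lt_i; have [lt_il|lt_li] := ltnP i l.+1; last first.
    have Ck j : (l < j)%N -> C j = e (j - l.+1)%N.
      rewrite leq_eqVlt => /orP[/eqP <-|lt_lj]; first by rewrite /C leqnn Sl subnn e0.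
      by rewrite /C leqNgt lt_lj.
    rewrite !Ck ?(leqW lt_li) // subSn //.
    have [|e_sub [a [ea nea _ _]]] := e_step (i - l.+1)%N; first by rewrite ltn_subLR.
    by split=> // /(_ a ea).
  rewrite /C lt_il ltnW //; split.
    by move=> _ [v [-> mv]]; exists v; split=> // j /ltnW; apply: mv.
  (* If [g i'] were already in [S i], subtracting this expression from [g i'] would give a relation
     whose coefficient at i' is the unit [1 - v 0 i']; b normalises it to 1. *)
  pose i' := Ordinal lt_il; move=> /(_ (g i')) Sg; apply: no_rel.
  have [|v [def_g mv]] := Sg.
    exists (delta_mx 0 i'); split=> [|j lt_ij].
      by rewrite sum_delta_mul.
    have /negbTE ne_ji : j != i' by rewrite neq_ltn lt_ij orbT.
    by rewrite mxE ne_ji andbF; apply: ideal0.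
  have [b b1] := local_unit_1B (mv i' (leqnn _)).
  exists (b *: (delta_mx 0 i' - v)), i'; split; first by rewrite !mxE !eqxx.
  transitivity (b * (\sum_j ((j == i')%:R * g j) - \sum_j v 0 j * g j)).
    rewrite -sumrB mulr_sumr; apply: eq_bigr => j _; rewrite !mxE eqxx /=.
    by rewrite -mulrBl mulrA.
  rewrite -def_g (bigD1 i') //= eqxx mul1r big1 ?addr0 ?subrr ?mulr0 // => j ne_j.
  by rewrite (negbTE ne_j) mul0r.
Qed.

End Local.

(** * Submodules as modules *)

Section SubmoduleType.
Variables (R : comNzRingType) (M : lmodType R) (S : set M).
Hypothesis hS : submodule S.

Definition submod_pred : {pred M} := fun x => `[< S x >].

Lemma submod_predP : submod_closed submod_pred.
Proof.
case: hS => S0 SD; split; first exact/asboolP.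
by move=> a x y /asboolP Sx /asboolP Sy; apply/asboolP/SD.
Qed.

(** The proof of [submodule S] is an argument of the type, so that the module structure can be
    inferred from the type alone. *)
Definition submod_type & submodule S := {x : M | submod_pred x}.

HB.instance Definition _ := SubType.copy (submod_type hS) {x : M | submod_pred x}.
HB.instance Definition _ := Choice.copy (submod_type hS) {x : M | submod_pred x}.
HB.instance Definition _ :=
  GRing.SubChoice_isSubLmodule.Build R M submod_pred (submod_type hS) submod_predP.

Definition submod_in (x : M) (Sx : S x) : submod_type hS := exist _ x (asboolT Sx).

Lemma submod_valP (x : submod_type hS) : S (val x).
Proof. by case: x => x Sx; apply/asboolP. Qed.

End SubmoduleType.

(** * Baer's criterion and linear systems *)

Section Solvability.
Variable R : comNzRingType.

(* Systems A zeta = delta that satisfy the obvious necessary condition have a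
   solution in W: maps from the row space of A to W extend to R^n. *)
Definition solvable_on (E : lmodType R) (W : set E) (p n : nat) (A : 'M[R]_(p, n)) : Prop :=
  forall delta : 'I_p -> E, (forall i, W (delta i)) ->
    (forall v : 'rV[R]_p, v *m A = 0 -> \sum_i v 0 i *: delta i = 0) ->
  exists zeta : 'I_n -> E, (forall d, W (zeta d)) /\
    forall i, \sum_d A i d *: zeta d = delta i.

(* Baer's criterion for W, an ideal being given by generators a and a map to W
   by the images delta of these generators. *)
Definition baer (E : lmodType R) (W : set E) : Prop :=
  forall (p : nat) (a : 'I_p -> R) (delta : 'I_p -> E), (forall i, W (delta i)) ->
    (forall v : 'rV[R]_p, \sum_i v 0 i * a i = 0 -> \sum_i v 0 i *: delta i = 0) ->
  exists2 w, W w & forall i, a i *: w = delta i.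

(** By compatibility, delta defines a map on the ideal generated by a; w is the image of 1 under an
    extension to R. *)
Lemma injective_baer (E : lmodType R) : injective_module E -> baer [set: E].
Proof.
move=> E_inj p a delta _ compat.
pose I : set R^o := [set y | exists v : 'rV[R]_p, y = \sum_i v 0 i *: (a i : R^o)].
have hI : submodule I := submodule_lincomb _.
have /choice [c cP] (y : submod_type hI) :
    exists v : 'rV[R]_p, val y = \sum_i v 0 i *: (a i : R^o).
  exact: submod_valP y.
pose f0 (y : submod_type hI) : E := \sum_i c y 0 i *: delta i.
have f0E (y : submod_type hI) (v : 'rV[R]_p) : val y = \sum_i v 0 i *: (a i : R^o) -> f0 y = \sum_i v 0 i *: delta i.
  move=> yv; apply/eqP; rewrite -subr_eq0 -sumrB; apply/eqP.
  transitivity (\sum_i (c y - v) 0 i *: delta i).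
    by apply: eq_bigr => i _; rewrite !mxE scalerBl.
  apply: compat; transitivity (val y - val y); last exact: subrr.
  rewrite {1}cP yv -sumrB; apply: eq_bigr => i _.
  by rewrite !mxE mulrBl.
have f0_lin : linear f0.
  move=> t y z; rewrite (f0E _ (t *: c y + c z)).
    rewrite scaler_sumr -big_split; apply: eq_bigr => i _.
    by rewrite !mxE scalerDl scalerA.
  rewrite linearP /= !cP scaler_sumr -big_split; apply: eq_bigr => i _.
  by rewrite !mxE scalerDl scalerA.
pose fL := GRing.isLinear.Build R (submod_type hI) E *:%R f0 f0_lin.
pose f : {linear submod_type hI -> E} := HB.pack f0 fL.
have [|h hP] := E_inj _ _ (\val : {linear submod_type hI -> R^o}) f; first exact: val_inj.
exists (h 1) => // i.
have Ia : I (a i).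
  by exists (delta_mx 0 i); rewrite sum_delta_scale.
rewrite -linearZ -[_ *: _]/(a i * 1) mulr1 -[a i]/(val (submod_in hI Ia)) hP.
rewrite -[f _]/(f0 _) (f0E _ (delta_mx 0 i)).
  by rewrite sum_delta_scale.
by rewrite sum_delta_scale.
Qed.

Hypothesis R_noetherian : noetherian R.

(** Induction on the number of unknowns. The relations B among the rows of the remaining columns A1
    give the conditions on the first unknown alone, which Baer's criterion solves. *)
Lemma baer_solvable (E : lmodType R) (W : set E) (p n : nat) (A : 'M[R]_(p, n)) :
  submodule W -> baer W -> solvable_on W A.
Proof.
move=> hW W_baer; elim: n A => [|n IHn] A delta Wdelta compat.
  exists (fun=> 0); split=> [[]//|i]; rewrite big_ord0.
  transitivity (\sum_j (delta_mx 0 i : 'rV_p) 0 j *: delta j).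
    by rewrite compat // thinmx0.
  by rewrite sum_delta_scale.
pose c := lsubmx (A : 'M_(p, 1 + n)); pose A1 := rsubmx (A : 'M_(p, 1 + n)).
have defA : A = row_mx c A1 :> 'M_(p, 1 + n) by rewrite hsubmxK.
have [|q [B BP]] := noetherian_rV R_noetherian (S := [set v : 'rV_p | v *m A1 = 0]).
  split; first by rewrite /= mul0mx.
  by move=> t v w /= v0 w0; rewrite mulmxDl -scalemxAl v0 w0 scaler0 addr0.
have BA1 : B *m A1 = 0.
  apply/row_matrixP => i; rewrite row_mul row0.
  by apply/(BP (row i B)); exists (delta_mx 0 i); rewrite -rowE.
have sumB (v : 'rV_q) : \sum_i v 0 i *: (\sum_j B i j *: delta j) =
    \sum_j (v *m B) 0 j *: delta j.
  under eq_bigr do rewrite scaler_sumr.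
  rewrite exchange_big; apply: eq_bigr => j _; rewrite mxE scaler_suml.
  by apply: eq_bigr => i _; rewrite scalerA.
have [||w Ww wP] := W_baer q (fun i => (B *m c) i 0) (fun i => \sum_j B i j *: delta j).
- by move=> i; apply: submodule_sum => // j _; apply: submoduleZ.
- move=> v v0; rewrite sumB; apply: compat.
  have vBc : v *m B *m c = 0.
    by apply/rowP=> i; rewrite (ord1 i) -mulmxA mxE [RHS]mxE -[RHS]v0.
  transitivity (v *m B *m row_mx c A1 : 'rV_(1 + n)); first by congr (_ *m _).
  by rewrite mul_mx_row vBc -mulmxA BA1 mulmx0 row_mx0.
have [||zeta [Wzeta zetaP]] := IHn A1 (fun i => delta i - c i 0 *: w).
- by move=> i; apply: submoduleB => //; apply: submoduleZ.
- move=> v /(BP v) [u ->].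
  under eq_bigr do rewrite scalerBr; rewrite sumrB -sumB; apply/eqP; rewrite subr_eq0; apply/eqP.
  under eq_bigr do rewrite -wP; under [RHS]eq_bigr do rewrite scalerA.
  rewrite -scaler_suml; under eq_bigr do rewrite scalerA; rewrite -scaler_suml; congr (_ *: _).
  transitivity ((u *m (B *m c)) 0 0); first by rewrite mxE.
  by rewrite mulmxA mxE.
exists (fun d => if unlift ord0 d is Some d' then zeta d' else w); split.
  by move=> d; case: unliftP.
move=> i; rewrite big_ord_recl unlift_none.
under eq_bigr do rewrite liftK.
have -> : A i ord0 = c i 0 by rewrite mxE; congr (A i _); apply/val_inj.
have -> : \sum_d A i (lift ord0 d) *: zeta d = \sum_d A1 i d *: zeta d.
  by apply: eq_bigr => d _; congr (_ *: _); rewrite mxE; congr (A i _); apply/val_inj.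
by rewrite zetaP addrC subrK.
Qed.

End Solvability.

(** * Extension of maps into modules of finite injective dimension *)

Section FiniteInjectiveDimension.
Variables (R : comNzRingType) (m : set R).
Hypotheses (R_noetherian : noetherian R) (R_local : local_ring m) (R_dim1 : krull_dim R 1).
Hypothesis R_red : reduced R.
Variable x : R.
Hypotheses (mx : m x) (x_reg : GRing.lreg x).

(** This embeds R / p in R / b. For p = m, use that m is an associated prime of R / x. Otherwise
    each generator of p is killed by an element outside p, and c is the product of these
    elements. *)
Lemma prime_is_colon (p : set R) : prime_ideal p ->
  exists b c : R, (b = 0 \/ b = x) /\ forall y, p y <-> exists z, y * c = z * b.
Proof.
move=> p_prime; have [hp np1 pM] := p_prime.
have [->|p_m] := pselect (p = m).
  have [|c nc c_prime] := associated_prime R_noetherian (ideal_principal x).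
    case=> y def1; have := local_not1 R_local; apply.
    by rewrite def1; apply: idealMl => //; apply: local_ideal.
  have colon_m : colon [set y | exists z, y = z * x] c = m.
    apply: (prime_regular R_noetherian R_local R_dim1 R_red c_prime) x_reg.
    by exists c; rewrite mulrC.
  by exists x, c; split; [right|move=> y; rewrite -[m y]/(m y) -colon_m].
have [q [g gp]] := noetherian_fg R_noetherian hp.
have pg i : p (g i).
  by apply/gp; exists (delta_mx 0 i); rewrite sum_delta_mul.
have /choice [s sP] : forall i, exists s, ~ p s /\ g i * s = 0.
  move=> i; have [s] := prime_zero_divisor R_noetherian R_local R_dim1 R_red p_prime p_m (pg i).
  by exists s.
exists 0, (\prod_i s i); split; first by left.
move=> y; split=> [/gp [v ->]|[z]].
  exists 0; rewrite mulr0 mulr_suml big1 // => i _; rewrite (bigD1 i) //=.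
  by rewrite mulrA -(mulrA (v 0 i)) (sP i).2 mulr0 mul0r.
rewrite mulr0 => y0; have : p (y * \prod_i s i) by rewrite y0; apply: ideal0.
case/pM => //; elim/big_ind: _ => [/np1//|a b pa pb /pM[]//|i _ psi].
by case: ((sP i).1 psi).
Qed.

(* By noetherian induction it suffices to extend maps from primes p.  As R / p
   embeds in R / b with b = 0 or b = x, such a map, given by an element e of E,
   can be corrected by lifting to E the extension to R / b of the map R / p -> E'
   defined by d e. *)
Lemma baer_kernel (E0 E E' : lmodType R) (d0 : {linear E0 -> E}) (d : {linear E -> E'}) :
  (forall y, d y = 0 <-> exists z, d0 z = y) ->
  baer [set: E0] -> baer [set: E] -> baer (range d) -> baer (range d0).
Proof.
move=> exact_d E0_baer E_baer d_baer.
have hW : submodule (range d0).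
  split; first by exists 0; rewrite ?linear0.
  by move=> a _ _ [y _ <-] [z _ <-]; exists (a *: y + z); rewrite ?linearP.
(* E0 is divisible by the regular element x, by [E0_baer]; hence so is its image. *)
have W_div w : range d0 w -> exists2 w', range d0 w' & x *: w' = w.
  move=> [e _ <-]; have [//||e' _ e'P] := E0_baer 1%N (fun=> x) (fun=> e).
    move=> v; rewrite !big_ord1 mulrC => xv0.
    by rewrite ((lreg_eq0P x).1 x_reg _ xv0) scale0r.
  by exists (d0 e'); rewrite -?linearZ ?(e'P ord0) //; exists e'.
have prime_case (p : set R) q (g : 'I_q -> R) (chi : 'I_q -> E) : prime_ideal p ->
    (forall y, p y <-> exists v : 'rV[R]_q, y = \sum_i v 0 i * g i) ->
    (forall i, range d0 (chi i)) ->
    (forall v : 'rV[R]_q, \sum_i v 0 i * g i = 0 -> \sum_i v 0 i *: chi i = 0) ->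
    exists2 w, range d0 w & forall i, g i *: w = chi i.
  move=> /prime_is_colon [b [c [b0x pP]]] gp Wchi compat.
  have [//|e _ eP] := E_baer q g chi _ compat.
  (* The equations [c *: z = d e] and [b *: z = 0] describe an extension to R / b of the map R / p
     -> E' given by d e. *)
  have [||z [z' _ zP] dz] := d_baer 2%N (fun i : 'I_2 => if i == 0 then c else b)
      (fun i : 'I_2 => if i == 0 then d e else 0).
  - by move=> i; case: ifP => _; [exists e|exists 0; rewrite ?linear0].
  - move=> v; rewrite !big_ord_recl !big_ord0 /= !addr0 scaler0 addr0 => v0.
    have /gp [u def_v] : p (v 0 ord0).
      apply/pP; exists (- v 0 (lift ord0 ord0)); apply/eqP.
      by rewrite mulNr -addr_eq0 v0.
    rewrite -linearZ def_v scaler_suml linear_sum big1 // => i _.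
    rewrite -scalerA eP; have /exact_d : exists z, d0 z = chi i by case: (Wchi i) => z' _ <-; exists z'.
    by rewrite linearZ_LR => ->; rewrite scaler0.
  have dz0 : c *: z = d e := dz ord0.
  have dz1 : b *: z = 0 := dz (lift ord0 ord0).
  (* For b = x, a preimage z' of z has [x *: z'] in the range of d0. Dividing by x inside that range
     gives the correction of z' that x kills. *)
  have [z1 bz1 dz1'] : exists2 z1, b *: z1 = 0 & d z1 = z.
    case: b0x dz1 => -> dz1; first by exists z' => //; rewrite scale0r.
    have /exact_d [y def_y] : d (x *: z') = 0 by rewrite linearZ /= zP.
    have [|w' [y' _ <-] xw'] := W_div (x *: z'); first by exists y.
    exists (z' - d0 y'); first by rewrite scalerBr xw' subrr.
    rewrite linearB /= zP; have /exact_d -> : exists z, d0 z = d0 y' by exists y'.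
    by rewrite subr0.
  exists (e - c *: z1).
    have /exact_d [y <-] : d (e - c *: z1) = 0; last by exists y.
    by rewrite linearB linearZ /= dz1' dz0 subrr.
  move=> i; rewrite scalerBr scalerA eP.
  have /pP [y ->] : p (g i); last by rewrite -scalerA bz1 scaler0 subr0.
  by apply/gp; exists (delta_mx 0 i); rewrite sum_delta_mul.
suff baer_I : forall I : set R, ideal I -> forall p (a : 'I_p -> R) (delta : 'I_p -> E),
    (forall y, I y <-> exists v : 'rV[R]_p, y = \sum_i v 0 i * a i) ->
    (forall i, range d0 (delta i)) ->
    (forall v : 'rV[R]_p, \sum_i v 0 i * a i = 0 -> \sum_i v 0 i *: delta i = 0) ->
    exists2 w, range d0 w & forall i, a i *: w = delta i.
  by move=> p a delta; apply: baer_I (@submodule_lincomb R R^o _ a) _ _ _ _.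
move=> I hI; elim/(noetherian_ind R_noetherian): I / hI => I hI IH p a delta aI Wdelta compat.
have [/aI [v def1]|nI1] := pselect (I 1).
  exists (\sum_i v 0 i *: delta i).
    by apply: submodule_sum => // i _; apply: submoduleZ.
  move=> k; rewrite scaler_sumr; apply/eqP; rewrite -subr_eq0; apply/eqP.
  transitivity (\sum_i (a k *: v - delta_mx 0 k) 0 i *: delta i).
    transitivity (\sum_i (a k * v 0 i) *: delta i - \sum_i ((i == k)%:R : R) *: delta i).
      congr (_ - _); first by apply: eq_bigr => i _; rewrite scalerA.
      rewrite (bigD1 k) //= eqxx scale1r big1 ?addr0 // => j ne_j.
      by rewrite (negbTE ne_j) scale0r.
    by rewrite -sumrB; apply: eq_bigr => i _; rewrite !mxE eqxx /= scalerBl.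
  apply: compat; transitivity (a k * (\sum_i v 0 i * a i) - \sum_i ((i == k)%:R : R) * a i).
    by rewrite mulr_sumr -sumrB; apply: eq_bigr => i _; rewrite !mxE eqxx /= mulrBl mulrA.
  rewrite -def1 mulr1 (bigD1 k) //= eqxx mul1r big1 ?addr0 ?subrr // => j ne_j.
  by rewrite (negbTE ne_j) mul0r.
(* Since [colon I c] is prime, [prime_case] provides an admissible value w at c. The map then
   extends to I + R c, where the induction hypothesis applies. *)
have [c nIc c_prime] := associated_prime R_noetherian hI nI1.
have [q [g gp]] := noetherian_fg R_noetherian (colon_ideal c hI).

have cg i : exists v : 'rV[R]_p, g i * c = \sum_j v 0 j * a j.
  by apply/aI; rewrite -[I _]/(colon I c (g i)); apply/gp; exists (delta_mx 0 i); rewrite sum_delta_mul.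
have {cg} /choice [C CP] := cg.
have sumC (v : 'rV_q) : \sum_i v 0 i *: (\sum_j C i 0 j *: delta j) =
    \sum_j (\sum_i v 0 i *: C i) 0 j *: delta j.
  under eq_bigr do rewrite scaler_sumr.
  rewrite exchange_big; apply: eq_bigr => j _; rewrite summxE scaler_suml.
  by apply: eq_bigr => i _; rewrite mxE scalerA.
have sumCa (v : 'rV_q) : \sum_j (\sum_i v 0 i *: C i) 0 j * a j = (\sum_i v 0 i * g i) * c.
  rewrite mulr_suml; transitivity (\sum_i \sum_j v 0 i * (C i 0 j * a j)).
    rewrite exchange_big; apply: eq_bigr => j _; rewrite summxE mulr_suml.
    by apply: eq_bigr => i _; rewrite mxE mulrA.
  by apply: eq_bigr => i _; rewrite -mulr_sumr -CP mulrA.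
have [||w Ww wP] := prime_case _ q g (fun i => \sum_j C i 0 j *: delta j) c_prime gp.
- by move=> i; apply: submodule_sum => // j _; apply: submoduleZ.
- by move=> v v0; rewrite sumC; apply: compat; rewrite sumCa v0 mul0r.
pose a' (i : 'I_p.+1) := if unlift ord_max i is Some j then a j else c.
pose delta' (i : 'I_p.+1) := if unlift ord_max i is Some j then delta j else w.
have a'E (v : 'rV_p.+1) : \sum_i v 0 i * a' i =
    \sum_j (\row_j v 0 (lift ord_max j)) 0 j * a j + v 0 ord_max * c.
  rewrite (bigD1_ord ord_max) //= addrC /a' unlift_none; congr (_ + _).
  by apply: eq_bigr => j _; rewrite liftK mxE.
have delta'E (v : 'rV_p.+1) : \sum_i v 0 i *: delta' i =
    \sum_j (\row_j v 0 (lift ord_max j)) 0 j *: delta j + v 0 ord_max *: w.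
  rewrite (bigD1_ord ord_max) //= addrC /delta' unlift_none; congr (_ + _).
  by apply: eq_bigr => j _; rewrite liftK mxE.
have [||||w' Ww' w'P] := IH _ (ideal_adjoin_ideal c hI) (@sub_ideal_adjoin _ I c) _ p.+1 a' delta'.
- by move=> /(_ c (mem_ideal_adjoin c hI)).
- move=> y; split=> [[t /aI [v vP]]|[v ->]].
    exists (\row_i if unlift ord_max i is Some j then v 0 j else t).
    rewrite a'E mxE unlift_none; apply/eqP; rewrite -subr_eq vP; apply/eqP.
    by apply: eq_bigr => j _; rewrite !mxE liftK.
  by exists (v 0 ord_max); rewrite a'E addrK; apply/aI; eexists.
- by move=> i; rewrite /delta'; case: unliftP.
- move=> v; rewrite a'E delta'E => /eqP; rewrite addr_eq0 => /eqP sum_v.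
  have /gp [u def_v] : colon I c (v 0 ord_max).
    rewrite /colon /= -[_ * _]opprK -sum_v; apply: idealN => //; apply/aI; by eexists.
  have -> : v 0 ord_max *: w = \sum_i (\sum_j u 0 j *: C j) 0 i *: delta i.
    rewrite def_v scaler_suml -sumC; apply: eq_bigr => i _.
    by rewrite -scalerA wP.
  rewrite -big_split /=; pose V : 'rV[R]_p := \row_j v 0 (lift ord_max j).
  pose U : 'rV[R]_p := \sum_j u 0 j *: C j; rewrite -/U -/V.
  transitivity (\sum_i (V + U) 0 i *: delta i).
    by apply: eq_bigr => i _; rewrite [in RHS]mxE scalerDl.
  apply: compat; transitivity (\sum_i V 0 i * a i + \sum_i U 0 i * a i).
    by rewrite -big_split; apply: eq_bigr => i _; rewrite [in LHS]mxE mulrDl.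
  by rewrite sumCa -def_v sum_v addNr.
exists w' => // i; have := w'P (lift ord_max i).
by rewrite /a' /delta' liftK.
Qed.

(* All cosyzygies of w are injective, so Ext^1(M, w) = 0 when M embeds in a free
   module: here M is the row space of A and the row space of A' its syzygy. *)
Lemma finite_injective_dim_extend (w : lmodType R) : finite_injective_dim w ->
  forall (q p n : nat) (A' : 'M[R]_(q, p)) (A : 'M[R]_(p, n)) (u : w) (z : 'cV[R]_q),
  (forall v : 'rV[R]_p, v *m A = 0 <-> exists v', v = v' *m A') ->
  (forall v : 'rV[R]_q, v *m A' = 0 -> v *m z = 0) ->
  exists y : 'I_p -> w, forall l, \sum_i A' l i *: y i = z l 0 *: u.
Proof.
move=> [E [d [eta [n0 [E_inj eta_inj exact0 exactS E_small]]]]].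
have d_baer k : baer (range (d k)).
  (* Descending induction on k: for k >= n0 the module [E k.+1], which contains [range (d k)], is
     zero. *)
  suff: forall j k, (n0 <= k + j)%N -> baer (range (d k)) by move/(_ n0 k); apply; rewrite leq_addl.
  elim=> {k} [|j IHj] k le_n0.
    rewrite addn0 in le_n0; move=> p a delta Wdelta _; exists 0; first by exists 0; rewrite ?linear0.
    by move=> i; rewrite scaler0 (E_small k.+1 (delta i)).
  apply: (@baer_kernel _ _ _ (d k) (d k.+1)) => //.
  - exact: injective_baer.
  - exact: injective_baer.
  - by apply: IHj; rewrite addSnnS.
have range_submodule k : submodule (range (d k)).
  split; first by exists 0; rewrite ?linear0.
  by move=> a _ _ [y _ <-] [y' _ <-]; exists (a *: y + y'); rewrite ?linearP.
move=> q p n A' A u z exactA zA'.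
have sumA' (M : lmodType R) (v : 'rV_q) (g : 'I_p -> M) :
    \sum_i v 0 i *: (\sum_j A' i j *: g j) = \sum_j (v *m A') 0 j *: g j.
  under eq_bigr do rewrite scaler_sumr.
  rewrite exchange_big; apply: eq_bigr => j _; rewrite mxE scaler_suml.
  by apply: eq_bigr => i _; rewrite scalerA.
have E0_sub : submodule [set: E 0%N] by [].
(* First extend the functional z u from the syzygy to R^p, with values in the injective module E
   0. *)
have [//||eps [_ epsP]] := @baer_solvable R R_noetherian (E 0%N) setT _ _ A' E0_sub (injective_baer (E_inj 0%N))
    (fun l => z l 0 *: eta u).
  move=> v /zA' /(congr1 (fun B : 'M_1 => B 0 0)); rewrite !mxE => vz.
  by under eq_bigr do rewrite scalerA; rewrite -scaler_suml vz scale0r.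
(* The composite of eps with d vanishes on the syzygy, so it extends from the row space of A to R^n
   within the range of d. Subtracting a lift y0 brings eps into the image of w, and A' A = 0
   preserves its values on the syzygy. *)
have [||zeta [Wzeta zetaP]] := @baer_solvable R R_noetherian _ _ _ _ A (range_submodule 0%N)
    (d_baer 0%N) (fun i => d 0%N (eps i)).
- by move=> i; exists (eps i).
- move=> v /exactA [v' ->]; rewrite -sumA' big1 // => l _.
  under eq_bigr do rewrite -linearZ; rewrite -linear_sum epsP linearZ.
  have /exact0 -> : exists y, eta y = eta u by exists u.
  by rewrite /= !scaler0.
have /choice [y0 y0P] : forall k, exists y, d 0%N y = zeta k.
  by move=> k; case: (Wzeta k) => y _ <-; exists y.
have /choice [y yP] : forall i, exists y, eta y = eps i - \sum_k A i k *: y0 k.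
  move=> i; apply/exact0; rewrite linearB linear_sum /=.
  under eq_bigr do rewrite linearZ /= y0P.
  by rewrite zetaP subrr.
exists y => l; apply: eta_inj; rewrite linearZ linear_sum /=.
under eq_bigr do rewrite linearZ /= yP scalerBr.
rewrite sumrB epsP (_ : \sum_i _ = 0) ?subr0 //.
have AA : A' *m A = 0.
  apply/row_matrixP => i; rewrite row_mul row0; apply/exactA.
  by exists (delta_mx 0 i); rewrite -rowE.
under eq_bigr do rewrite scaler_sumr.
rewrite exchange_big big1 // => k _.
under eq_bigr do rewrite scalerA; rewrite -scaler_suml.
by have /matrixP/(_ l k) := AA; rewrite !mxE => ->; rewrite scale0r.
Qed.

End FiniteInjectiveDimension.

(** * The canonical module and the torsion of w / R u *)

Section CanonicalModule.
Variables (R : comNzRingType) (m : set R).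
Hypotheses (R_noetherian : noetherian R) (R_local : local_ring m) (R_dim1 : krull_dim R 1).
Hypothesis R_red : reduced R.
Let hm := local_ideal R_local.

Lemma depth_unique (M : lmodType R) t t' : depth m M t -> depth m M t' -> t = t'.
Proof.
move=> [[s <- s_reg] s_max] [[s' <- s'_reg] s'_max].
by apply/eqP; rewrite eqn_leq s'_max ?s_max.
Qed.

Lemma krull_dim_unique d d' : krull_dim R d -> krull_dim R d' -> d = d'.
Proof.
move=> [[c hc] c_max] [[c' hc'] c'_max].
by apply/eqP; rewrite eqn_leq (c'_max _ _ hc) (c_max _ _ hc').
Qed.

Lemma depth1_regular (M : lmodType R) : depth m M 1 ->
  exists2 x, m x & forall v : M, x *: v = 0 -> v = 0.
Proof.
move=> [[[//|x [|//]] _ [mx x_reg _]] _]; exists x; first by apply: mx; rewrite inE.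
move=> v xv0.
have [|n [c [z [zP ->]]]] := x_reg 0%N v isT.
  by rewrite /= xv0; apply: (submodule_span_submodule _).1.
by apply: big1 => i _; have [a [b []]] := zP i.
Qed.

Section CohomologicalType.
Variable (w : lmodType R).
Hypotheses (w_type : cm_type m w 1) (w_depth : depth m w 1).

(* An element v of w with m v <= y w gives the 1-cocycle z |-> (z v) / y of m,
   that is, a class in Ext^1(k, w). *)
Lemma socle_cyclic (y : R) (v1 v2 : w) : (forall v : w, y *: v = 0 -> v = 0) ->
  (forall a, m a -> exists v, a *: v1 = y *: v) ->
  (forall a, m a -> exists v, a *: v2 = y *: v) ->
  ~ (exists v, v1 = y *: v) -> exists r v, v2 - r *: v1 = y *: v.
Proof.
move=> y_reg soc1 soc2 nv1; have [x mx x_reg] := depth1_regular w_depth.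
have [t [k [F [t_depth [pi [pi_surj piP]] len_ext]]]] := w_type.
have t1 : t = 1%N := depth_unique t_depth w_depth.
move: len_ext; rewrite t1 => -[_ len_ext].
(* h lifts the augmentation F 0 -> k to R, so it maps boundaries into m and a lift e of the class of
   1 to a unit. *)
have [h hP] := res_projective (p := F) (g := pi) (res_aug F) pi_surj.
have hd_m z : m (h (res_diff F 0 z)).
  by apply/piP; rewrite hP; apply/res_aug_exact; exists z.
have [e eP] := res_aug_surj F (pi 1).
have [b be] : exists b, b * h e = 1.
  apply: (local_unit R_noetherian R_local) => mhe; apply: (local_not1 R_local).
  by apply/piP; rewrite -eP -hP; apply/piP.
have y_inj v v' : y *: v = y *: v' :> w -> v = v'.
  move=> /eqP; rewrite -subr_eq0 -scalerBr => /eqP/y_reg/eqP.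
  by rewrite subr_eq0 => /eqP.
have cocycle (v : w) : (forall a, m a -> exists v', a *: v = y *: v') ->
    exists2 phi : F 1%N -> w, ext_cocycles w F 1 phi &
      forall z, y *: phi z = h (res_diff F 0 z) *: v.
  move=> soc_v.
  have /choice [phi phiP] : forall z : F 1%N, exists v', h (res_diff F 0 z) *: v = y *: v'.
    by move=> z; apply/soc_v/hd_m.
  exists phi => //; split.
    move=> a z z'; apply: y_inj; rewrite scalerDr scalerA mulrC -scalerA -!phiP.
    by rewrite !linearP scalerDl scalerA.
  move=> z; apply: y_reg; rewrite -phiP.
  have /res_diff_exact -> : exists z', res_diff F 1 z' = res_diff F 1 z by exists z.
  by rewrite linear0 scale0r.
(* As x kills k, [x *: e] is a boundary. Comparing values there and cancelling x and the unit [h e]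
   exhibits v as a multiple of y. *)
have coboundary (v : w) (phi : F 1%N -> w) :
    (forall z, y *: phi z = h (res_diff F 0 z) *: v) ->
    ext_coboundaries w F 1 phi -> exists v', v = y *: v'.
  move=> phiP [g g_lin def_phi]; exists (b *: g e).
  have gZ a z : g (a *: z) = a *: g z.
    have g0 : g 0 = 0 by have := g_lin (-1) 0 0; rewrite scaler0 addr0 scaleN1r addNr.
    by have := g_lin a z 0; rewrite g0 !addr0.
  suff : y *: g e = h e *: v.
    by rewrite scalerA mulrC -scalerA => ->; rewrite scalerA be scale1r.
  apply/eqP; rewrite -subr_eq0; apply/eqP/x_reg; rewrite scalerBr.
  have /res_aug_exact [z def_z] : res_aug F (x *: e) = 0.
    by rewrite linearZ /= eP -linearZ; apply/piP; rewrite -[_ *: _]/(x * 1) mulr1.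
  have hxe : h (x *: e) = x * h e by rewrite linearZ.
  have := phiP z; rewrite def_phi /= def_z gZ hxe !scalerA (mulrC x y) => ->.
  by rewrite subrr.
have [phi1 Zphi1 phi1P] := cocycle v1 soc1.
have [phi2 Zphi2 phi2P] := cocycle v2 soc2.
have funE a (f g : F 1%N -> w) z : (a *: f + g) z = a *: f z + g z by [].
pose B := ext_coboundaries w F 1; pose Z := ext_cocycles w F 1.
have Z_sub : submodule Z.
  split; first by split=> [a z z'|z]; rewrite /= ?scaler0 ?addr0.
  move=> a f g [f_lin fd] [g_lin gd]; split=> [c z z'|z] /=; last first.
    by rewrite funE fd gd scaler0 addr0.
  rewrite !funE f_lin g_lin !scalerDr !scalerA addrACA.
  by congr (_ *: _ + _ + _); rewrite mulrC.
have B_sub : submodule B.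
  split; first by exists (fun=> 0) => // a z z'; rewrite scaler0 addr0.
  move=> a _ _ [f f_lin ->] [g g_lin ->].
  exists (fun z => a *: f z + g z) => // c z z'.
  rewrite f_lin g_lin !scalerDr !scalerA addrACA.
  by congr (_ *: _ + _ + _); rewrite mulrC.
have BZ : B `<=` Z.
  move=> _ [g g_lin ->]; split=> [a z z'|z] /=; first by rewrite linearP g_lin.
  have /res_diff_exact -> : exists z', res_diff F 1 z' = res_diff F 1 z by exists z.
  have := g_lin (-1) 0 0; by rewrite scaler0 addr0 scaleN1r addNr.
pose adj (S : set (F 1%N -> w)) (phi : F 1%N -> w) : set (F 1%N -> w) :=
  [set psi | exists r, S (psi - r *: phi)].
have adj_sub S phi : submodule S -> submodule (adj S phi).
  move=> hS; split; first by exists 0; rewrite scale0r subr0; apply: hS.1.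
  move=> a f g [r Sf] [r' Sg]; exists (a * r + r').
  have -> : a *: f + g - (a * r + r') *: phi = a *: (f - r *: phi) + (g - r' *: phi).
    by rewrite scalerBr scalerDl opprD addrACA scalerA.
  exact: hS.2.
have adjS S phi : S `<=` adj S phi by move=> f Sf; exists 0; rewrite scale0r subr0.
have adj_in S phi : submodule S -> adj S phi phi.
  by move=> hS; exists 1; rewrite scale1r subrr; apply: hS.1.
have adjZ S phi : S `<=` Z -> Z phi -> adj S phi `<=` Z.
  move=> SZ Zphi f [r /SZ Zf]; rewrite -(subrK (r *: phi) f).
  by apply: submoduleD => //; apply: submoduleZ.
have [[r Br]|nBphi2] := pselect (adj B phi1 phi2).
  exists r; apply: coboundary Br => z.
  rewrite -[(phi2 - r *: phi1) z]/(phi2 z - r *: phi1 z) !scalerBr phi2P.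
  by rewrite [in X in _ - X]scalerA (mulrC y) -scalerA phi1P !scalerA (mulrC r).
(* When phi2 lies outside B + R phi1, the submodules B, B + R phi1 and B + R phi1 + R phi2 form a
   chain of length 2, against type 1. *)
have : (2 <= 1)%N; last by [].
apply: (len_ext 2%N (fun i => if i is i'.+1 then if i' is 0%N then adj B phi1
                             else adj (adj B phi1) phi2 else B)).
split=> [[|[|[|//]]]|[|[|//]]] _ /=.
- by split.
- by split; [apply: adj_sub|apply: adjS|apply: adjZ].
- split; [exact: (adj_sub _ _ (adj_sub _ _ B_sub))| |by apply: (adjZ) => //; apply: adjZ].
  by apply: subset_trans (adjS _ _); apply: adjS.
- split=> [|eqB]; first exact: adjS.
  apply: nv1; apply: coboundary phi1P _.
  by rewrite -[ext_coboundaries _ _ _]/B eqB; apply: adj_in.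
- split=> [|eqB]; first exact: adjS.
  by apply: nBphi2; rewrite eqB; apply/adj_in/adj_sub.
Qed.

End CohomologicalType.

(** Copies of a composition series of R / x, multiplied by the powers of x, are glued end to end; l
    steps amount to one factor x. *)
Lemma power_filtration (x : R) : m x -> GRing.lreg x ->
  exists (l : nat) (D : nat -> set R),
  [/\ (0 < l)%N, D 0%N = setT, forall k, ideal (D k),
      forall n, D (n * l)%N = [set z | exists y, z = y * x ^+ n] &
      forall k, D k.+1 `<=` D k /\ exists a, [/\ D k a, ~ D k.+1 a,
        forall y, D k y -> exists r, D k.+1 (y - r * a) &
        forall y, m y -> D k.+1 (y * a)]].
Proof.
move=> mx x_reg.
have [|l [c [c0 cl c_ideal c_step]]] := composition_seriesP R_noetherian R_local R_dim1
    R_red (ideal_principal x) _ x_reg; first by exists 1; rewrite mul1r.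
have l_gt0 : (0 < l)%N.
  rewrite lt0n; apply/eqP => l0; apply: (local_not1 R_local).
  have : c l 1 by rewrite cl.
  by rewrite l0 c0 => -[y ->]; apply: idealMl.
pose D k : set R := [set z | exists2 y, c (l - k %% l)%N y & z = y * x ^+ (k %/ l)].
have xn_reg n y : y * x ^+ n = 0 -> y = 0.
  elim: n y => [|n IHn] y; first by rewrite mulr1.
  by rewrite exprSr mulrA mulrC => /((lreg_eq0P x).1 x_reg)/IHn.
have DS k : D k.+1 = [set z | exists2 y, c (l - (k %% l).+1)%N y & z = y * x ^+ (k %/ l)].
  have [lt_kl|] := ltnP (k %% l).+1 l.
    have [dk mk] : (k.+1 %/ l)%N = (k %/ l)%N /\ (k.+1 %% l)%N = (k %% l).+1.
      have eqk : k.+1 = (k %/ l * l + (k %% l).+1)%N by rewrite addnS -divn_eq.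
      by rewrite eqk divnMDl // modnMDl (modn_small lt_kl) (divn_small lt_kl) addn0.
    by rewrite /D dk mk.
  rewrite leq_eqVlt ltnNge ltn_pmod // orbF => /eqP eq_l.
  have [dk mk] : (k.+1 %/ l)%N = (k %/ l).+1 /\ (k.+1 %% l)%N = 0%N.
    have eqk : k.+1 = ((k %/ l).+1 * l)%N by rewrite mulSn [X in (X + _)%N]eq_l addSn addnC -divn_eq.
    by rewrite eqk mulnK // modnMl.
  rewrite /D dk mk subn0 cl -eq_l subnn c0; apply/seteqP; split=> z.
    by move=> [y _ ->]; exists (y * x); [exists y|rewrite exprS mulrA].
  by move=> [_ [y ->] ->]; exists y => //; rewrite exprS mulrA.
exists l, D; split=> //.
- apply/seteqP; split=> // z _; rewrite /D /= mod0n subn0 cl div0n; exists z => //.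
  by rewrite mulr1.
- move=> k; apply: idealP => [|_ _ [y cy ->] [z cz ->]|a _ [y cy ->]].
  + by exists 0; rewrite ?mul0r //; apply: ideal0.
  + by exists (y + z); rewrite ?mulrDl //; apply: idealD.
  + by exists (a * y); rewrite ?mulrA //; apply: idealMl.
- move=> n; rewrite /D modnMl mulnK // subn0 cl; apply/seteqP; split=> z.
    by move=> [y _ ->]; exists y.
  by move=> [y ->]; exists y.
move=> k; rewrite DS /D.
have lt_l : (l - (k %% l).+1 < l)%N by rewrite ltn_subrL l_gt0.
have [c_sub [a [ca nca cP ma]]] := c_step _ lt_l.
rewrite subnSK ?ltn_pmod // in c_sub ca cP; split.
  by move=> _ [y cy ->]; exists y => //; apply: c_sub.
exists (a * x ^+ (k %/ l)); split.
- by exists a.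
- move=> [y cy /eqP]; rewrite -subr_eq0 -mulrBl => /eqP/xn_reg/eqP.
  by rewrite subr_eq0 => /eqP eq_a; apply: nca; rewrite eq_a.
- move=> _ [y cy ->]; have [r cr] := cP y cy.
  by exists r, (y - r * a) => //; rewrite mulrBl mulrA.
- by move=> y my; exists (y * a); rewrite ?mulrA //; apply: ma.
Qed.

(* The length of w / x^n w is at most n l, with l the length of R / x, whereas
   R u / (R u :&: x^n w) already has length at least (n - n0) l.  Hence the chain
   R u + x^n w cannot decrease strictly for all n. *)
Lemma cokernel_torsion (w : lmodType R) (u : w) (x : R) :
  fin_gen w -> cm_type m w 1 -> depth m w 1 ->
  m x -> (forall v : w, x *: v = 0 -> v = 0) -> (forall r : R, r *: u = 0 -> r = 0) ->
  exists N, forall v, exists r, x ^+ N *: v = r *: u.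
Proof.
move=> w_fg w_type w_depth mx x_reg u_reg.
have x_lreg : GRing.lreg x.
  apply/lreg_eq0P => y xy0; apply/u_reg/x_reg.
  by rewrite scalerA xy0 scale0r.
have xn_reg n (v : w) : x ^+ n *: v = 0 -> v = 0.
  elim: n v => [|n IHn] v; first by rewrite scale1r.
  by rewrite exprS -scalerA => /x_reg/IHn.
have [l [D [l_gt0 D0 D_ideal Dn D_step]]] := power_filtration mx x_lreg.
have D_anti j k : (j <= k)%N -> D k `<=` D j.
  elim: k => [|k IHk]; first by rewrite leqn0 => /eqP ->.
  rewrite leq_eqVlt ltnS => /orP[/eqP -> //|/IHk]; apply: subset_trans.
  by have [] := D_step k.
have [p [g gP]] := fin_genP w_fg.
pose lin (v : 'rV[R]_p) := \sum_i v 0 i *: g i.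
have linP a v v' : lin (a *: v + v') = a *: lin v + lin v'.
  rewrite scaler_sumr -big_split; apply: eq_bigr => i _.
  by rewrite !mxE scalerDl scalerA.
have Ru_sub : submodule [set v : w | exists r, v = r *: u].
  split; first by exists 0; rewrite scale0r.
  by move=> a _ _ [r ->] [s ->]; exists (a * r + s); rewrite scalerDl scalerA.
(* The elements that some power of x sends into R u form a finitely generated submodule, so a single
   exponent serves for all of them. *)
have [n0 n0P] : exists n0, forall n v, (exists r, x ^+ n *: v = r *: u) ->
    exists r, x ^+ n0 *: v = r *: u.
  have [|q [A AP]] := noetherian_rV R_noetherian
      (S := [set v : 'rV[R]_p | exists n r, x ^+ n *: lin v = r *: u]).
    split; first by exists 0%N, 0; rewrite /lin big1 ?scaler0 ?scale0r // => i _; rewrite mxE scale0r.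
    move=> a v v' [n [r rP]] [k [s sP]].
    exists (n + k)%N, (a * (x ^+ k * r) + x ^+ n * s).
    rewrite linP scalerDr scalerDl; congr (_ + _).
      by rewrite -scalerA -scalerA -rP !scalerA; congr (_ *: _); rewrite exprD; ring.
    by rewrite -scalerA -sP !scalerA exprD.
  have /choice [n nP] : forall i, exists n r, x ^+ n *: lin (row i A) = r *: u.
    by move=> i; apply/(AP (row i A)); exists (delta_mx 0 i); rewrite -rowE.
  exists (\max_i n i)%N => k v; have [c ->] := gP v; move=> v_tors.
  have [|d def_c] := (AP c).1; first by exists k.
  have -> : \sum_i c 0 i *: g i = \sum_j d 0 j *: lin (row j A).
    rewrite def_c; under [RHS]eq_bigr do rewrite /lin scaler_sumr.
    rewrite exchange_big; apply: eq_bigr => i _; rewrite mxE scaler_suml.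
    by apply: eq_bigr => j _; rewrite scalerA mxE.
  rewrite scaler_sumr.
  apply: (submodule_sum (S := [set v : w | exists r, v = r *: u])) => // j _.
  have [r rP] := nP j; exists (d 0 j * (x ^+ (\max_i n i - n j) * r)).
  rewrite -2![in RHS]scalerA -rP !scalerA; congr (_ *: _).
  have {1}<- : (\max_i n i - n j + n j = \max_i n i)%N by rewrite subnK // leq_bigmax.
  by rewrite exprD; ring.
(* Once x^n w lies in R u + x^(n+1) w, Nakayama's lemma gives x^n w <= R u. *)
have [n nP] : exists n, forall v, exists r v', x ^+ n *: v = r *: u + x ^+ n.+1 *: v'.
  apply: contrapT => /forallNP not_stable.
  (* With these values q + n = n l + 1, one step more than the filtration H allows. *)
  pose n := (n0 * l).+1; pose q := ((n - n0) * l)%N.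
  have le_n0 : (n0 <= n)%N by rewrite /n ltnW // ltnS leq_pmulr.
  suff: (q + n <= n * l)%N.
    move=> le_q; suff: (n <= n0 * l)%N by rewrite /n ltnn.
    rewrite -(leq_add2l q); apply: leq_trans le_q _.
    by rewrite /q mulnBl subnK // leq_mul2r le_n0 orbT.
  (* [H k / x^n w] is the annihilator of [D (n * l - k)] in w / x^n w, so H descends from w to x^n
     w. [socle_cyclic] shows that its factors are simple or zero. *)
  pose H k : set w := [set v | forall d, D (n * l - k)%N d -> exists v', d *: v = x ^+ n *: v'].
  (* C runs from (D q) u + x^n w to R u + x^n w, strictly by the choice of n0, and then up to w,
     strictly by [not_stable]. *)
  pose C i : set w := if (i <= q)%N
    then [set v | exists d v', D (q - i)%N d /\ v = d *: u + x ^+ n *: v']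
    else [set v | exists r v', v = r *: u + x ^+ (n - (i - q)) *: v'].
  have Cq i : (q <= i)%N -> C i = [set v | exists r v', v = r *: u + x ^+ (n - (i - q)) *: v'].
    rewrite leq_eqVlt => /orP[/eqP <-|lt_qi]; last by rewrite /C leqNgt lt_qi.
    rewrite /C leqnn subnn subn0 D0; apply/seteqP; split=> v.
      by move=> [d [v' [_ ->]]]; exists d, v'.
    by move=> [d [v' ->]]; exists d, v'.
  apply: (@chain_bound R w H _ _ _ C).
  - move=> k lt_k v v' Hv Hv' nHv.
    have eqk : (n * l - k = (n * l - k.+1).+1)%N by rewrite subnSK.
    have [_ [a [Da nDa DP ma]]] := D_step (n * l - k.+1)%N.
    rewrite -eqk in nDa DP ma.
    have [||[v'' def_v'']|r [v'' v''P]] :=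
        @socle_cyclic w w_type w_depth (x ^+ n) (a *: v) (a *: v') (xn_reg n).
    + by move=> b mb; have [v'' v''P] := Hv _ (ma _ mb); exists v''; rewrite scalerA v''P.
    + by move=> b mb; have [v'' v''P] := Hv' _ (ma _ mb); exists v''; rewrite scalerA v''P.
    + apply: nHv => d /DP [r /Hv [z zP]]; exists (z + r *: v'').
      by rewrite scalerDr -zP scalerA (mulrC _ r) -scalerA -def_v'' scalerA -scalerDl subrK.
    + exists r => d /DP [s Ds].
      have [z zP] := Hv _ Ds; have [z' z'P] := Hv' _ Ds.
      exists (z' - r *: z + s *: v'').
      have -> : x ^+ n *: (z' - r *: z + s *: v'') =
          (d - s * a) *: v' - r *: ((d - s * a) *: v) + s *: (a *: v' - r *: (a *: v)).
        by rewrite zP z'P v''P scalerDr scalerBr !scalerA (mulrC r) (mulrC s).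
      rewrite !scalerBr !scalerA addrACA -opprD -!scalerDl; congr (_ *: _ - _ *: _); ring.
  - have HC v : H (n * l)%N v -> exists v', v = x ^+ n *: v'.
      by rewrite /H subnn D0 => /(_ 1 I) [v']; rewrite scale1r => ->; exists v'.
    move=> i le_i; split.
    + rewrite /C; case: ifP => _.
        split; first by exists 0, 0; split; [apply: ideal0|rewrite scale0r scaler0 addr0].
        move=> a _ _ [d [v [Dd ->]]] [d' [v' [Dd' ->]]]; exists (a * d + d'), (a *: v + v').
        split; first by apply: idealD => //; apply: idealMl.
        by rewrite scalerDl !scalerDr !scalerA addrACA (mulrC a (x ^+ n)).
      split; first by exists 0, 0; rewrite scale0r scaler0 addr0.
      move=> a _ _ [d [v ->]] [d' [v' ->]]; exists (a * d + d'), (a *: v + v').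
      by rewrite scalerDl !scalerDr !scalerA addrACA (mulrC a (x ^+ _)).
    + move=> v /HC [v' ->]; rewrite /C; case: ifP => [le_iq|_].
        by exists 0, v'; split; [apply: ideal0|rewrite scale0r add0r].
      exists 0, (x ^+ (i - q) *: v'); rewrite scale0r add0r scalerA -exprD subnK //.
      by rewrite leq_subLR.
    + move=> v _ d; rewrite subn0 Dn => -[y ->]; exists (y *: v).
      by rewrite scalerA mulrC.
  - move=> i lt_i; have [lt_iq|le_qi] := ltnP i q; last first.
      rewrite !Cq ?leqW // subSn // subnS.
      have lt_iqn : (i - q < n)%N by rewrite ltn_subLR.
      set k := (n - (i - q)).-1.
      have -> : (n - (i - q) = k.+1)%N by rewrite /k prednK // subn_gt0.
      split=> [_ [r [v ->]]|sub].
        by exists r, (x *: v); rewrite scalerA -exprSr.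
      apply: (not_stable k) => v; have [|r [v' rP]] := sub (x ^+ k *: v).
        by exists 0, v; rewrite scale0r add0r.
      by exists r, v'.
    rewrite /C lt_iq ltnW //.
    have eqq : (q - i = (q - i.+1).+1)%N by rewrite subnSK.
    have [D_sub [a [Da nDa _ _]]] := D_step (q - i.+1)%N.
    rewrite -eqq in D_sub nDa; split.
      by move=> _ [d [v [Dd ->]]]; exists d, v; split=> //; apply: D_sub.
    move=> /(_ (a *: u)) [|d [v [Dd auP]]].
      by exists a, 0; rewrite scaler0 addr0.
    have [|r rP] := n0P n v; first by exists (a - d); rewrite scalerBl auP addrAC subrr add0r.
    apply: nDa; have def_a : a - d = r * x ^+ (n - n0).
      apply/eqP; rewrite -subr_eq0; apply/eqP/u_reg; rewrite scalerBl scalerBl auP.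
      by rewrite [X in X - _]addrC addKr mulrC -scalerA -rP scalerA -exprD subnK // subrr.
    rewrite -(subrK d a) def_a; apply: idealD => //.
    apply: (D_anti _ q); first exact: leq_subr.
    by rewrite Dn; exists r.
exists n => v; have [c ->] := gP v; rewrite scaler_sumr.
apply: (submodule_sum (S := [set v : w | exists r, v = r *: u])) => // i _.
rewrite scalerA mulrC -scalerA; apply: submoduleZ => //.
have /choice [r rP] : forall i, exists r v', x ^+ n *: g i = r *: u + x ^+ n.+1 *: v'.
  by move=> j; apply: nP.
have /choice [v' v'P] := rP; have /choice [e eP] : forall i, exists c, v' i = lin c by move=> j; apply: gP.
apply: (nakayama R_noetherian R_local (g := fun i => x ^+ n *: g i) (A := fun i j => x * e i 0 j)) => //.
  by move=> k j; apply: idealMr.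
move=> j; exists (r j); rewrite v'P eP [X in _ - X](_ : _ = x ^+ n.+1 *: lin (e j)) ?addrK //.
by rewrite scaler_sumr; apply: eq_bigr => k _; rewrite !scalerA exprS; congr (_ *: _); ring.
Qed.

End CanonicalModule.

(** * Almost Gorenstein rings and descent along syzygies *)

Section AlmostGorenstein.
Variables (R : comNzRingType) (m : set R).
Hypotheses (R_noetherian : noetherian R) (R_local : local_ring m) (R_dim1 : krull_dim R 1).
Hypothesis R_red : reduced R.
Let hm := local_ideal R_local.

(** For C nonzero the dimension is 0, so e is the length of C, and e is at most the size q of a
    minimal generating family. If m C were nonzero, 0 < m C followed by q strict steps up to C would
    be a chain of length q + 1. *)
Lemma ulrich_killed (C : lmodType R) (z : R) (e : nat) :
  GRing.lreg z -> (forall c : C, z *: c = 0) ->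
  multiplicity m C e -> min_number_gens C e ->
  forall a (c : C), m a -> a *: c = 0.
Proof.
move=> z_reg zC mult_C [[s0 _ gen_s0] e_min] a c ma.
case: mult_C => [[C0 _]|[s [p [n0 [[[P [P_prime P_strict]] _] len_p size_p def_e]]]]].
  exact: C0.
(* A prime containing the annihilator of C contains z, hence is m. *)
have s0' : s = 0%N.
  apply/eqP; rewrite -leqn0 leqNgt; apply/negP => s_gt0.
  have Pm i : (i <= s)%N -> P i = m.
    move=> /P_prime [Pi_prime /(_ z zC) Pz].
    exact: prime_regular Pz z_reg.
  by have [_] := P_strict 0%N s_gt0; rewrite !Pm.
have p_const n : p.[n] = e%:R.
  rewrite s0' in def_e size_p; rewrite def_e mul1r.
  by rewrite (size1_polyC size_p) hornerC coefC.
have [|L [I_ [I0 IL I_ideal I_step]]] := composition_seriesP R_noetherian R_local R_dim1 R_red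
  (ideal_principal z) _ z_reg; first by exists 1; rewrite mul1r.
(* The k-th term of the series of R / z kills m^k C; at k = L this reads m^L C = 0. *)
have adic_I k : (k <= L)%N -> forall y b, adic m C k y -> I_ k b -> b *: y = 0.
  elim: k => [|k IHk] lt_kL y b.
    by rewrite I0 => _ [b' ->]; rewrite -scalerA zC scaler0.
  have [_ [d [_ _ dP md]]] := I_step _ lt_kL.
  move=> [n [t [y' [y'P ->]]]] Ib; rewrite scaler_sumr big1 // => i _.
  have [g [y0 [mg y0P ->]]] := y'P i.
  have gb0 : (g * b) *: y0 = 0.
    apply: (IHk (ltnW lt_kL)) => //.
    have [r Ir] := dP b Ib; rewrite -(subrK (r * d) b) mulrDr; apply: idealD => //.
      exact: idealMl.
    by rewrite mulrA; apply: md; apply: idealMr.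
  by rewrite !scalerA (_ : b * t i * g = t i * (g * b)); [rewrite -scalerA gb0 scaler0|ring].
have adic0 k : (L <= k)%N -> forall y, adic m C k y -> y = 0.
  elim: k => [|k IHk]; first by rewrite leqn0 => /eqP L0 y _; rewrite -[y]scale1r (adic_I 0%N) // -[in I_ _]L0 IL.
  rewrite leq_eqVlt => /orP[/eqP <- y Ly|/IHk adk y [n [t [y' [y'P ->]]]]].
    by rewrite -[y]scale1r (adic_I L) // IL.
  rewrite big1 // => i _; have [g [y0 [_ /adk -> ->]]] := y'P i.
  by rewrite !scaler0.
have C_fg : fin_gen C by exists s0.
have [p0 [g0 g0P]] := fin_genP C_fg.
have [q [g [gP mg]]] := minimal_lincomb R_noetherian R_local g0.
have {}gP y : exists v : 'rV[R]_q, y = \sum_i v 0 i *: g i by apply/gP/g0P.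
have le_eq : (e <= q)%N.
  have := e_min (codom g); rewrite size_codom card_ord; apply.
  apply/seteqP; split=> // y _; have [v ->] := gP y.
  apply: submodule_sum; first exact: submodule_span_submodule.
  move=> i _; apply: submoduleZ; first exact: submodule_span_submodule.
  by apply: sub_submodule_span => /=; apply: codom_f.
apply: contrapT => ac_neq0; pose n := maxn n0 L.
have [l [_ l_max]] := len_p n (leq_maxl _ _).
rewrite p_const => /eqP; rewrite Num.Theory.eqr_nat => /eqP def_l; rewrite {}def_l in l_max.
pose S i : set C := [set y | exists v : 'rV[R]_q,
  y = \sum_j v 0 j *: g j /\ forall j : 'I_q, (i <= j)%N -> m (v 0 j)].
have S_sub i : submodule (S i).
  split.
    exists 0; split=> [|j _]; last by rewrite mxE; apply: ideal0.
    by rewrite big1 // => j _; rewrite mxE scale0r.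
  move=> b _ _ [v [-> mv]] [v' [-> mv']]; exists (b *: v + v'); split=> [|j ij].
    rewrite scaler_sumr -big_split; apply: eq_bigr => j _.
    by rewrite !mxE scalerDl scalerA.
  by rewrite !mxE; apply: idealD => //; [apply: idealMl => //; apply: mv|apply: mv'].
have adn_sub : submodule (adic m C n).
  by case: (n) => [|k]; [split|apply: submodule_span_submodule].
have adnS i : adic m C n `<=` S i.
  by move=> y /(adic0 _ (leq_maxr _ _)) ->; apply: (S_sub i).1.
suff: (q.+1 <= e)%N by move=> /leq_trans/(_ le_eq); rewrite ltnn.
apply: (l_max _ (fun i => if i is i'.+1 then S i' else adic m C n)); split.
  by move=> [|i] _; split.
move=> [_|i lt_i].
  split=> [|eqS]; first exact: adnS.
  apply: ac_neq0; apply: (adic0 _ (leq_maxr n0 L)); rewrite eqS.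
  have [v ->] := gP c; exists (a *: v); split=> [|j _]; last by rewrite mxE; apply: idealMr.
  by rewrite scaler_sumr; apply: eq_bigr => j _; rewrite mxE scalerA.
have lt_iq : (i < q)%N by [].
split=> [y [v [-> mv]]|eqS]; first by exists v; split=> // j /ltnW; apply: mv.
pose i' := Ordinal lt_iq.
have : S i.+1 (g i').
  exists (delta_mx 0 i'); split=> [|j lt_ij]; first by rewrite sum_delta_scale.
  have /negbTE ne_ji : j != i' by rewrite neq_ltn lt_ij orbT.
  by rewrite mxE ne_ji andbF; apply: ideal0.
rewrite -eqS => -[v [def_g mv]]; apply: (local_not1 R_local).
have /mg/(_ i') : \sum_j (delta_mx 0 i' - v) 0 j *: g j = 0.
  under eq_bigr do rewrite mxE [X in _ + X]mxE scalerBl.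
  by rewrite sumrB sum_delta_scale -def_g subrr.
rewrite !mxE !eqxx /= => m1v.
by rewrite -(subrK (v 0 i') 1); apply: idealD => //; apply: mv.
Qed.

(** [cokernel_torsion] makes a power of x kill C = w / R u; [ulrich_killed], applied to that power,
    makes all of m kill C. *)
Lemma almost_gorenstein_canonical : almost_gorenstein m ->
  exists (w : lmodType R) (u : w) (x : R),
  [/\ finite_injective_dim w, m x, GRing.lreg x,
      forall r : R, r *: u = 0 -> r = 0 &
      forall a (v : w), m a -> exists r, a *: v = r *: u].
Proof.
move=> [_ [w [[[w_fg [d [dimR w_depth]]] w_type w_inj] [C [f [g [C_fg f_inj exact g_surj [e C_mult C_min]]]]]]]].
rewrite (krull_dim_unique dimR R_dim1) in w_depth.
have [x mx x_reg] := depth1_regular w_depth.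
have fE (r : R) : f r = r *: f 1 by rewrite -linearZ -[_ *: _]/(r * 1) mulr1.
have u_reg (r : R) : r *: f 1 = 0 -> r = 0.
  by rewrite -fE -[RHS](linear0 f) => /f_inj.
have x_lreg : GRing.lreg x.
  apply/lreg_eq0P => y xy0; apply/u_reg/x_reg.
  by rewrite scalerA xy0 scale0r.
exists w, (f 1), x; split=> // a v ma.
have [N NP] := cokernel_torsion R_noetherian R_local R_dim1 R_red w_fg w_type w_depth mx x_reg u_reg.
have gu (y : w) : (exists r : R, y = r *: f 1) -> g y = 0.
  by move=> [r ->]; apply/exact; exists r; rewrite fE.
have xC (c : C) : x ^+ N *: c = 0.
  by have [y <-] := g_surj c; rewrite -linearZ gu.
have /exact [r rP] : g (a *: v) = 0.
  by rewrite linearZ; apply: ulrich_killed C_mult C_min _ _ ma; [apply: lregX x_lreg|].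
by exists r; rewrite -rP fE.
Qed.

(* Multiplication by r on the row space of A factors through R^p: it lifts to
   R^p along the surjection v |-> v A. *)
Definition factors_through_free (r : R) (p n : nat) (A : 'M[R]_(p, n)) : Prop :=
  exists X : 'M[R]_p, X *m A = r *: A /\ forall v : 'rV[R]_p, v *m A = 0 -> v *m X = 0.

Lemma factors_syzygy (r : R) (q p n : nat) (A' : 'M[R]_(q, p)) (A : 'M[R]_(p, n)) :
  almost_gorenstein m ->
  (forall v : 'rV[R]_p, v *m A = 0 <-> exists v', v = v' *m A') ->
  (forall l i, m (A' l i)) ->
  factors_through_free r A' -> factors_through_free r A.
Proof.
move=> /almost_gorenstein_canonical [w [u [x [w_inj mx x_reg u_reg mw]]]] exactA mA' [X' [X'A' X'ker]].
have AA : A' *m A = 0.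
  apply/row_matrixP => i; rewrite row_mul row0; apply/exactA.
  by exists (delta_mx 0 i); rewrite -rowE.
(* Column j of X' is a functional on the syzygy; its product with u extends to R^p as the scalar
   product with a vector [y j] of w. *)
have /choice [y yP] : forall j, exists y : 'I_p -> w,
    forall l, \sum_i A' l i *: y i = X' l j *: u.
  move=> j; have [|y yP] := finite_injective_dim_extend R_noetherian R_local R_dim1 R_red mx x_reg
    w_inj u (z := col j X') exactA.
    by move=> v /X'ker vX'; rewrite colE mulmxA vX' mul0mx.
  by exists y => l; rewrite yP mxE.
have /choice [b bP] : forall t : 'I_q * 'I_p * 'I_p, exists r : R,
    A' t.1.1 t.1.2 *: y t.1.1 t.2 = r *: u.
  by move=> t; apply: mw.
have bE j c i : A' j c *: y j i = b (j, c, i) *: u := bP (j, c, i).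
have u_inj (s t : R) : s *: u = t *: u -> s = t.
  move=> /eqP; rewrite -subr_eq0 -scalerBl => /eqP/u_reg/eqP.
  by rewrite subr_eq0 => /eqP.
(* With R u identified with R, the subtracted matrix is Y A', where Y has entries [y j i] in row i
   and column j. Then Y A' A = 0 and A' Y A' = X' A' = r A', which give the two conditions. *)
exists (r%:M - \matrix_(i, c) \sum_j b (j, c, i)); split.
  rewrite mulmxBl mul_scalar_mx; apply/eqP; rewrite subr_eq addrC -subr_eq subrr eq_sym; apply/eqP.
  apply/matrixP=> i d; rewrite !mxE; under eq_bigr do rewrite mxE mulr_suml.
  rewrite exchange_big big1 // => j _; apply: u_inj; rewrite scale0r scaler_suml.
  transitivity ((A' *m A) j d *: y j i); last by rewrite AA mxE scale0r.
  rewrite mxE scaler_suml; apply: eq_bigr => c _.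
  by transitivity (A c d *: (A' j c *: y j i)); [rewrite bE scalerA mulrC|rewrite scalerA mulrC].
move=> v /exactA [v' ->]; rewrite -mulmxA.
suff -> : A' *m (r%:M - \matrix_(i, c) \sum_j b (j, c, i)) = 0 by rewrite mulmx0.
rewrite mulmxBr mul_mx_scalar; apply/eqP; rewrite subr_eq0 -X'A'; apply/eqP.
apply/matrixP=> l c; rewrite !mxE; apply: u_inj; rewrite !scaler_suml.
transitivity (\sum_j \sum_i (A' l i * b (j, c, i)) *: u).
  apply: eq_bigr => j _; rewrite mulrC -scalerA -yP scaler_sumr.
  apply: eq_bigr => i _; rewrite scalerA mulrC -!scalerA; congr (_ *: _).
  exact: bE.
rewrite exchange_big; apply: eq_bigr => i _; rewrite mxE mulr_sumr scaler_suml.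
by [].
Qed.

End AlmostGorenstein.

(** * Free modules and free resolutions *)

Section FreeModules.
Variable R : comNzRingType.

Section LinearCombination.
Variables (M : lmodType R) (p : nat) (g : 'I_p -> M).

Definition lincomb (v : 'rV[R]_p) : M := \sum_i v 0 i *: g i.

Lemma lincomb_linear : linear lincomb.
Proof.
move=> a v w; rewrite scaler_sumr -big_split; apply: eq_bigr => i _.
by rewrite !mxE scalerDl scalerA.
Qed.

HB.instance Definition _ := GRing.isLinear.Build R 'rV[R]_p M *:%R lincomb lincomb_linear.

End LinearCombination.

Lemma linear_rV (M : lmodType R) (p : nat) (f : 'rV[R]_p -> M) (v : 'rV[R]_p) :
  linear f -> f v = \sum_i v 0 i *: f (delta_mx 0 i).
Proof.
move=> f_lin.
pose fL : {linear 'rV[R]_p -> M} := HB.pack f (GRing.isLinear.Build R 'rV[R]_p M *:%R f f_lin).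
rewrite -[f v]/(fL v) {1}[v]row_sum_delta linear_sum; apply: eq_bigr => i _.
by rewrite linearZ.
Qed.

Lemma rV_projective (p : nat) : projective_module 'rV[R]_p.
Proof.
move=> A B g f g_surj.
have /choice [a aP] : forall i : 'I_p, exists a, g a = f (delta_mx 0 i).
  by move=> i; apply: g_surj.
exists (lincomb a : {linear _ -> _}) => v; rewrite /= /lincomb linear_sum /=.
rewrite [RHS]linear_rV; last exact: linearP.
by apply: eq_bigr => i _; rewrite linearZ /= aP.
Qed.

Section FreeResolution.
Variables (M : lmodType R) (n : nat -> nat).
Variables (g : 'I_(n 0%N) -> M) (A : forall i, 'M[R]_(n i.+1, n i)).
Hypothesis g_surj : forall y, exists v, lincomb g v = y.
Hypothesis g_exact : forall v, lincomb g v = 0 <-> exists v', v' *m A 0 = v.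
Hypothesis A_exact : forall i (v : 'rV_(n i.+1)), v *m A i = 0 <-> exists v', v' *m A i.+1 = v.

Definition free_resolution : projective_resolution M :=
  @ProjectiveResolution R M (fun i => 'rV[R]_(n i)) (fun i => mulmxr (A i))
    (lincomb g) (fun i => @rV_projective (n i)) g_surj g_exact A_exact.

End FreeResolution.

End FreeModules.

Lemma submod_val_sum (R : comNzRingType) (M : lmodType R) (S : set M) (hS : submodule S)
    (p : nat) (v : 'rV[R]_p) (g : 'I_p -> submod_type hS) :
  \val (\sum_i v 0 i *: g i) = \sum_i v 0 i *: \val (g i).
Proof. by rewrite linear_sum; apply: eq_bigr => i _; rewrite linearZ. Qed.

(** * The inclusion of ca(R) in co(R) *)

Section CohomologyAnnihilator.
Variables (R : comNzRingType) (m : set R).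
Hypotheses (R_noetherian : noetherian R) (R_local : local_ring m).

Lemma minimal_generators (n : nat) (S : set 'rV[R]_n) : submodule S ->
  exists (p : nat) (A : 'M[R]_(p, n)), (forall y, S y <-> exists v, v *m A = y) /\
    forall v : 'rV[R]_p, v *m A = 0 -> forall i, m (v 0 i).
Proof.
move=> hS; have [p [A AS]] := noetherian_rV R_noetherian hS.
have [q [h [hA mh]]] := minimal_lincomb R_noetherian R_local (fun i => row i A).
have mulB v : v *m (\matrix_i h i) = \sum_i v 0 i *: h i.
  by rewrite mulmx_sum_row; apply: eq_bigr => i _; rewrite rowK.
exists q, (\matrix_i h i); split=> [y|v]; last by rewrite mulB; apply: mh.
have := hA y; rewrite AS => hAy; split=> [[v ->]|[v <-]].
  have [|w wP] := (hA (v *m A)).1; first by exists v; rewrite mulmx_sum_row.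
  by exists w; rewrite mulB.
have [|w wP] := (hA (v *m \matrix_i h i)).2; first by exists v; rewrite mulB.
by exists w; rewrite wP mulmx_sum_row.
Qed.

(** Minimality is recorded as entries in m, the form in which [factors_syzygy] needs it. *)
Lemma minimal_free_resolution (M : lmodType R) : fin_gen M ->
  exists (n : nat -> nat) (g : 'I_(n 0%N) -> M) (A : forall i, 'M[R]_(n i.+1, n i)),
  [/\ forall y, exists v, lincomb g v = y,
      forall v, lincomb g v = 0 <-> exists v', v' *m A 0 = v,
      forall i (v : 'rV_(n i.+1)), v *m A i = 0 <-> exists v', v' *m A i.+1 = v &
      forall i l c, m (A i l c)].
Proof.
move=> /fin_genP [p0 [g0 g0P]].
have [n0 [g [g0g mg]]] := minimal_lincomb R_noetherian R_local g0.
(* The iteration runs over pairs of a rank q and a subset of R^q, the current syzygy. [gens] is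
   conditional so that a choice exists for every pair. *)
pose T := {q : nat & set 'rV[R]_q}.
have gens (x : T) : exists y : {p : nat & 'M[R]_(p, projT1 x)}, submodule (projT2 x) ->
    (forall v, projT2 x v <-> exists v', v' *m projT2 y = v) /\
    forall v : 'rV[R]_(projT1 y), v *m projT2 y = 0 -> forall i, m (v 0 i).
  have [hx|nhx] := pselect (submodule (projT2 x)).
    by have [p [A AP]] := minimal_generators hx; exists (existT _ p A).
  by exists (existT _ 0%N (0 : 'M[R]_(0, projT1 x))) => /nhx.
pose F x := projT1 (cid (gens x)).
have FP (x : T) := projT2 (cid (gens x)) : submodule (projT2 x) ->
    (forall v, projT2 x v <-> exists v', v' *m projT2 (F x) = v) /\
    forall v : 'rV[R]_(projT1 (F x)), v *m projT2 (F x) = 0 -> forall i, m (v 0 i).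
pose next (x : T) : T := existT _ (projT1 (F x)) [set v | v *m projT2 (F x) = 0].
pose x0 : T := existT _ n0 [set v | lincomb g v = 0].
pose st i : T := iter i next x0.
have st_sub i : submodule (projT2 (st i)).
  case: i => [|i]; split; rewrite /= ?mul0mx ?linear0 // => a v w v0 w0.
    by rewrite linearP /= v0 w0 scaler0 addr0.
  by rewrite mulmxDl -scalemxAl v0 w0 scaler0 addr0.
pose n i := projT1 (st i).
pose A i : 'M[R]_(n i.+1, n i) := projT2 (F (st i)).
exists n, g, A; split.
- by move=> y; have /g0g [v ->] := g0P y; exists v.
- exact: (FP _ (st_sub 0%N)).1.
- by move=> i; apply: (FP _ (st_sub i.+1)).1.
move=> [|i] l c.
  have : lincomb g (row l (A 0%N)) = 0.
    by apply/((FP _ (st_sub 0%N)).1 (row l (A 0%N))); exists (delta_mx 0 l); rewrite -rowE.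
  by move/mg/(_ c); rewrite mxE.
have : row l (A i.+1) *m A i = 0.
  by apply/((FP _ (st_sub i.+1)).1 (row l (A i.+1))); exists (delta_mx 0 l); rewrite -rowE.
by move/(FP _ (st_sub i)).2/(_ c); rewrite mxE.
Qed.

Hypotheses (R_dim1 : krull_dim R 1) (R_red : reduced R).
Hypothesis R_almost_gorenstein : almost_gorenstein m.

Lemma annihilator_factors (r : R) (I : set R) : cohomology_annihilator R r -> ideal I ->
  exists (p : nat) (a : 'cV[R]_p), (forall y, I y <-> exists v : 'rV_p, (v *m a) 0 0 = y) /\
    factors_through_free r a.
Proof.
move=> [k k_gt0 r_ca] hI; have [p [h hP]] := noetherian_fg R_noetherian hI.
have Ih i : I (h i) by apply/hP; exists (delta_mx 0 i); rewrite sum_delta_mul.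
pose M : lmodType R := submod_type (hI : @submodule R R^o I).
have M_fg : fin_gen M.
  apply: (@fin_gen_lincomb R M p (fun i => submod_in hI (Ih i))) => y.
  have /hP [v vP] := submod_valP y; exists v; apply/val_inj.
  by rewrite vP submod_val_sum.
have [n [g [A [g_surj g_exact A_exact mA]]]] := minimal_free_resolution M_fg.
(* Let N be the row space of [A i]. The projection onto N is a cocycle in degree i.+1, and r times
   it is a coboundary: r id_N extends to a map g' on the free module in degree i. Lifting g' through
   [A i] gives the factorisation. *)
have factors_A i : (k <= i.+1)%N -> factors_through_free r (A i).
  move=> le_ki; pose K := [set v | exists v' : 'rV_(n i.+1), v' *m A i = v].
  have hK : submodule K.
    split; first by exists 0; rewrite mul0mx.
    by move=> a _ _ [v <-] [w <-]; exists (a *: v + w); rewrite mulmxDl -scalemxAl.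
  pose N : lmodType R := submod_type hK.
  have inK v : K (v *m A i) by exists v.
  have N_fg : fin_gen N.
    apply: (@fin_gen_lincomb R N _ (fun l => submod_in hK (inK (delta_mx 0 l)))) => y.
    have [v vP] := submod_valP y; exists v; apply/val_inj.
    rewrite -vP submod_val_sum mulmx_sum_row; apply: eq_bigr => l _.
    by rewrite rowE.
  pose G := free_resolution g_surj g_exact A_exact.
  have [|g' g'_lin g'P] := r_ca i.+1 M N le_ki M_fg N_fg G (fun v => submod_in hK (inK v)).
    split=> [a v w|v]; apply/val_inj; rewrite /= ?mulmxDl -?scalemxAl //.
    have /A_exact -> // : exists v', v' *m A i.+1 = v *m A i.+1 by exists v.
  have g'A v : \val (g' (v *m A i)) = r *: (v *m A i).
    by move/(congr1 (fun f => \val (f v))): g'P => /= <-.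
  have /choice [z zP] (c : 'I_(n i)) : exists z, z *m A i = \val (g' (delta_mx 0 c)).
    exact: (submod_valP (g' (delta_mx 0 c) : submod_type hK)).
  have g'E (v : 'rV_(n i)) : \val (g' v) = v *m (\matrix_c z c) *m A i.
    rewrite (linear_rV (M := N) v g'_lin) submod_val_sum [v *m _]mulmx_sum_row mulmx_suml.
    by apply: eq_bigr => c _; rewrite -zP rowK scalemxAl.
  exists (A i *m \matrix_c z c); split.
    apply/row_matrixP => l; rewrite !rowE -!mulmxA mulmxA -[LHS]mulmxA.
    rewrite [A i *m (_ *m _)]mulmxA mulmxA [_ *m (A i *m _)]mulmxA -g'E g'A.
    by rewrite scalemxAr.
  by move=> v v0; rewrite mulmxA v0 mul0mx.
(* Descend from degree k to degree 0 with [factors_syzygy]; one more use of it below reaches the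
   ideal itself. *)
have factors_A0 : factors_through_free r (A 0%N).
  suff: forall j i, (k <= i + j)%N -> factors_through_free r (A i) by move/(_ k 0%N); apply.
  elim=> [|j IHj] i le_k; first by apply: factors_A; rewrite addn0 in le_k; apply: leqW.
  apply: (factors_syzygy R_noetherian R_local R_dim1 R_red R_almost_gorenstein _ (mA i.+1)).
    by move=> v; rewrite A_exact; split=> -[v' ?]; exists v'.
  by apply: IHj; rewrite addSnnS.
have col_lin (v : 'rV_(n 0%N)) : \val (lincomb g v) = (v *m \col_i (\val (g i) : R)) 0 0.
  by rewrite /lincomb submod_val_sum mxE; apply: eq_bigr => i _; rewrite mxE.
exists (n 0%N), (\col_i \val (g i)); split.
  move=> y; split=> [Iy|[v <-]]; last by rewrite -col_lin; apply: submod_valP.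
  have [v vP] := g_surj (submod_in hI Iy); exists v.
  by rewrite -col_lin vP.
apply: (factors_syzygy R_noetherian R_local R_dim1 R_red R_almost_gorenstein _ (mA 0%N)) => //.
move=> v; rewrite (_ : v *m _ = 0 <-> lincomb g v = 0).
  by rewrite g_exact; split=> -[v' ?]; exists v'.
split=> [v0|v0]; first by apply/val_inj; rewrite col_lin v0 mxE linear0.
by apply/rowP=> i; rewrite (ord1 i) -col_lin v0 linear0 mxE.
Qed.

Lemma annihilator_conductor (Q : comUnitRingType) (iota : {rmorphism R -> Q}) (r : R) (x : Q) :
  total_quotient_ring iota -> cohomology_annihilator R r -> integralOver iota x ->
  range iota (iota r * x).
Proof.
move=> [iota_inj iota_unit iota_frac] r_ca [p p_monic px].
(* s clears the denominators of x^i for i up to the degree of p, hence those of all of R[x] after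
   reduction modulo p. *)
have [a [b [b_reg def_x]]] := iota_frac x.
pose d := (size p).-1; pose s := b ^+ d.
have s_unit : iota s \is a GRing.unit by rewrite rmorphXn unitrX // iota_unit.
have sx i : (i <= d)%N -> range iota (iota s * x ^+ i).
  move=> le_id; exists (b ^+ (d - i) * a ^+ i) => //.
  rewrite def_x /s -{2}(subnK le_id) exprD !rmorphM !rmorphXn exprMn exprVn -!mulrA.
  by congr (_ * _); rewrite mulrCA mulrV ?mulr1 // unitrX // iota_unit.
have sh (h : {poly R}) : range iota (iota s * (map_poly iota h).[x]).
  rewrite (Pdiv.RingMonic.rdivp_eq p_monic h) rmorphD rmorphM hornerD hornerM (rootP px).
  rewrite mulr0 add0r; set f := Pdiv.Ring.rmodp h p.
  have lt_fp : (size f < size p)%N by rewrite Pdiv.Ring.ltn_rmodpN0 // monic_neq0.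
  rewrite (@horner_coef_wide _ (size f)) ?size_poly // mulr_sumr.
  have /choice [c cP] : forall i : 'I_(size f), exists c, iota c = iota s * x ^+ i.
    move=> i; have [|c _ <-] := sx i; last by exists c.
    by rewrite -ltnS; apply: leq_trans (ltn_ord i) _; rewrite (leq_trans (ltnW lt_fp)) ?leqSpred.
  exists (\sum_(i < size f) f`_i * c i) => //; rewrite rmorph_sum; apply: eq_bigr => i _.
  by rewrite rmorphM /= cP coef_map mulrCA.
(* This is s R[x], an ideal of R stable under multiplication by x. *)
pose I : set R := [set v | exists h : {poly R}, iota v = iota s * (map_poly iota h).[x]].
have hI : ideal I.
  apply: idealP => [|v v' [h vh] [h' vh']|c v [h vh]].
  - by exists 0; rewrite !rmorph0 horner0 mulr0.
  - by exists (h + h'); rewrite !rmorphD hornerD mulrDr vh vh'.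
  - by exists (c *: h); rewrite rmorphM vh map_polyZ hornerZ mulrCA.
have xI v : I v -> exists2 v', I v' & iota v' = iota v * x.
  move=> [h vh]; have [v' _ v'P] := sh (h * 'X); exists v'; first by exists (h * 'X).
  by rewrite v'P rmorphM /= map_polyX hornerM hornerX vh mulrA.
have [k [c [cI [X [Xc Xker]]]]] := annihilator_factors r_ca hI.
have [|v0 v0s] := (cI s).1; first by exists 1; rewrite rmorph1 hornerC mulr1.
have Ic j : I (c j 0).
  by apply/cI; exists (delta_mx 0 j); rewrite -rowE mxE.
have /choice [y yP] : forall j, exists y : 'rV_k, iota ((y *m c) 0 0) = iota (c j 0) * x.
  by move=> j; have [v' /cI [y <-] y_x] := xI _ (Ic j); exists y.
pose t j := (v0 *m X) 0 j.
(* With e_l the l-th unit row, [c l 0 *: v0] - s e_l is a relation between the generators c, so X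
   kills it. *)
have sX l j : s * X l j = c l 0 * t j.
  have v0c : v0 *m c = const_mx s by apply/rowP=> i; rewrite (ord1 i) v0s mxE.
  have E : c l 0 *: (v0 *m X) = s *: row l X.
    apply/eqP; rewrite -subr_eq0 rowE !scalemxAl -mulmxBl Xker // mulmxBl -!scalemxAl -rowE v0c.
    by apply/rowP=> i; rewrite (ord1 i) !mxE mulrC subrr.
  by move/rowP/(_ j): E; rewrite /t !mxE => ->.
(* r x is the trace of the matrix with rows [y j *m X]: s times its j-th diagonal entry is c_j t_j
   x, and these sum to s r x. *)
exists (\sum_j (y j *m X) 0 j) => //; apply: (mulrI s_unit).
have -> : iota s * (iota r * x) = \sum_j iota (t j) * (iota (c j 0) * x).
  have rs : r * s = \sum_j t j * c j 0.
    transitivity ((v0 *m X *m c) 0 0); last by rewrite mxE.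
    by rewrite -mulmxA Xc -scalemxAr mxE v0s.
  rewrite mulrA -rmorphM (mulrC s) rs rmorph_sum mulr_suml.
  by apply: eq_bigr => j _; rewrite rmorphM mulrA.
rewrite -rmorphM mulr_sumr rmorph_sum; apply: eq_bigr => j _.
rewrite -yP -rmorphM; congr (iota _); rewrite !mxE !mulr_sumr.
by apply: eq_bigr => l _; rewrite mulrCA sX; ring.
Qed.
End CohomologyAnnihilator.

(** * The integral closure as a Pruefer ring *)

Section IntegralClosure.
Variables (R : comNzRingType) (m : set R).
Hypotheses (R_noetherian : noetherian R) (R_local : local_ring m) (R_dim1 : krull_dim R 1).
Hypothesis R_red : reduced R.

Lemma reduced_sqr (y : R) : y * y = 0 -> y = 0.
Proof. by move=> yy; apply: (R_red (n := 2)); rewrite expr2. Qed.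

(** Choose a so that the double annihilator [bian (b + a)] is maximal. If z kills b + a, it kills
    both a and b, and replacing a by a + z cannot enlarge this ideal; this forces z z = 0. *)
Lemma regular_complement (b : R) : exists2 a, b * a = 0 & GRing.lreg (b + a).
Proof.
pose bian y : set R := [set z | forall t, t * y = 0 -> t * z = 0].
have bian_ideal y : ideal (bian y).
  apply: idealP => [t _|z z' zP z'P t ty|c z zP t ty]; rewrite ?mulr0 //.
    by rewrite mulrDr zP // z'P // addr0.
  by rewrite mulrCA zP // mulr0.
have [|J [_ [a [ba defJ]] _ Jmax]] := noetherian_max R_noetherian
    (P := fun J => exists a, b * a = 0 /\ J = bian (b + a)) (bian_ideal (b + 0)).
  by exists 0; rewrite mulr0.
exists a => //; apply/lreg_eq0P => z baz.
have bz : b * z = 0.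
  apply: reduced_sqr; transitivity (z * (b * ((b + a) * z)) - z * z * (b * a)); first by ring.
  by rewrite baz ba !mulr0 subrr.
have az : a * z = 0 by rewrite -baz mulrDl bz add0r.
have baz' : b * (a + z) = 0 by rewrite mulrDr ba bz addr0.
have JK : J `<=` bian (b + (a + z)).
  rewrite defJ => y yP t tP; apply: yP.
  have tz : t * z = 0.
    apply: reduced_sqr; transitivity (t * ((t * (b + (a + z))) * z) - t * t * (b * z) - t * t * (a * z)).
      by ring.
    by rewrite tP bz az mul0r !mulr0 !subrr.
  by transitivity (t * (b + (a + z)) - t * z); [ring|rewrite tP tz subrr].
have := Jmax _ (bian_ideal _) (ex_intro _ (a + z) (conj baz' erefl)) JK (b + (a + z)).
rewrite defJ => /(_ (fun _ => id) z); rewrite mulrC baz => /(_ erefl).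
rewrite (_ : z * (b + (a + z)) = b * z + a * z + z * z); last by ring.
by rewrite bz az !add0r => /reduced_sqr.
Qed.

Variables (Q : comUnitRingType) (iota : {rmorphism R -> Q}).
Hypothesis Q_total : total_quotient_ring iota.
Notation O := (integralOver iota).

(** With b = b0 / s and b0 a = 0, one has b0 b0 = b0 (b0 + a), where b0 + a becomes invertible. So Q
    is von Neumann regular. *)
Lemma quasi_inverse (b : Q) : exists b', b * b' * b = b.
Proof.
have [_ iota_unit iota_frac] := Q_total; have [b0 [s [s_reg ->]]] := iota_frac b.
have [a ba ba_reg] := regular_complement b0.
exists (iota s / iota (b0 + a)).
transitivity ((iota b0 * iota b0 / iota (b0 + a)) * (iota s / iota s) / iota s); first by ring.
rewrite divrr ?iota_unit // mulr1 -rmorphM; congr (_ / _).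
have -> : b0 * b0 = b0 * (b0 + a) by rewrite mulrDr ba addr0.
by rewrite rmorphM mulrK ?iota_unit.
Qed.

Lemma integral_idempotent (e : Q) : e * e = e -> O e.
Proof.
move=> ee; exists ('X * ('X - 1)).
  by rewrite monicMl ?monicX // -polyC1 monicXsubC.
rewrite rmorphM rmorphB /= map_polyX rmorph1 /root hornerM hornerX hornerD hornerN hornerX hornerC.
by rewrite mulrBr mulr1 ee subrr.
Qed.

Lemma integral_sum (I : Type) (r : seq I) (P : pred I) (F : I -> Q) :
  (forall i, P i -> O (F i)) -> O (\sum_(i <- r | P i) F i).
Proof.
by move=> OF; elim/big_ind: _ => //; [exact: integral0|move=> x y; apply: integral_add].
Qed.

(* Determinant trick on the span of 1, q, ..., q^(n-1). *)
Lemma integral_stable (q y : Q) (n : nat) : (0 < n)%N ->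
  (forall i, (i < n)%N -> exists2 h : {poly R}, (size h <= n)%N &
     y * q ^+ i = (map_poly iota h).[q]) ->
  O y.
Proof.
case: n => // n _ stable.
have /choice [h hP] : forall i : 'I_n.+1, exists h : {poly R}, (size h <= n.+1)%N /\
    y * q ^+ i = (map_poly iota h).[q].
  by move=> i; have [h] := stable i (ltn_ord i); exists h.
pose H : 'M[R]_n.+1 := \matrix_(i, k) (h i)`_k.
exists (char_poly H); first exact: char_poly_monic.
rewrite map_char_poly; set Hq := map_mx iota H.
pose V : 'cV[Q]_n.+1 := \col_k q ^+ k.
have HV : (y%:M - Hq) *m V = 0.
  apply/colP=> i; rewrite mulmxBl mul_scalar_mx !mxE (hP i).2.
  rewrite (@horner_coef_wide _ n.+1); last by rewrite (leq_trans (size_poly _ _)) ?(hP i).1.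
  by apply/eqP; rewrite subr_eq0; apply/eqP/eq_bigr => k _; rewrite coef_map !mxE.
(* The entry of V at index 0 is 1, so multiplying HV by the adjugate shows that the determinant
   vanishes. *)
have det0 : \det (y%:M - Hq) = 0.
  have := congr1 (mulmx (\adj (y%:M - Hq))) HV.
  rewrite mulmxA mul_adj_mx mulmx0 mul_scalar_mx => /colP/(_ ord0).
  by rewrite !mxE expr0 mulr1.
rewrite /root /char_poly -horner_evalE -det_map_mx -det0; apply/eqP; congr (\det _).
apply/matrixP=> i j; rewrite !mxE /= horner_evalE hornerD hornerN hornerC.
by rewrite hornerMn hornerX.
Qed.

(** Multiply the tail by q^i. For i < j the degree stays below [size f]; for i >= j, the equation
    f(q) = 0 replaces q^j times the tail by minus the lower part of f. Thus [integral_stable]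
    applies. *)
Lemma seidenberg (f : {poly R}) (q : Q) (j : nat) : f != 0 -> (map_poly iota f).[q] = 0 ->
  O (map_poly iota (drop_poly j f)).[q].
Proof.
move=> f_neq0 fq; apply: (@integral_stable q _ (size f)); first by rewrite size_poly_gt0.
move=> i lt_if; have [lt_ij|le_ji] := ltnP i j.
  exists (drop_poly j f * 'X^i); last first.
    by rewrite rmorphM /= map_polyXn hornerM hornerXn.
  rewrite (leq_trans (size_polyMleq _ _)) // size_polyXn addnS /= size_drop_poly.
  case: (leqP j (size f)) => [le_j|/ltnW]; last first.
    by rewrite -subn_eq0 => /eqP ->; rewrite add0n ltnW.
  by rewrite -{2}(subnK le_j) leq_add2l ltnW.
exists (- take_poly j f * 'X^(i - j)).
  rewrite (leq_trans (size_polyMleq _ _)) // size_polyXn addnS /= size_polyN.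
  by apply: leq_trans (leq_add (size_take_poly _ _) (leqnn _)) _; rewrite subnKC // ltnW.
rewrite rmorphM rmorphN /= map_polyXn hornerM hornerN hornerXn.
have := fq; rewrite -{1}(poly_take_drop j f) rmorphD rmorphM /= map_polyXn hornerD hornerM hornerXn.
move/eqP; rewrite addr_eq0 => /eqP ->; rewrite opprK -mulrA; congr (_ * _).
by rewrite -exprD addnC subnK.
Qed.

Variable x : R.
Hypotheses (mx : m x) (x_reg : GRing.lreg x).

Lemma unit_coefficient (q : Q) : exists (f : {poly R}) (k : nat),
  f`_k = 1 /\ (map_poly iota f).[q] = 0.
Proof.
have [_ iota_unit iota_frac] := Q_total; have [a [b [b_reg ->]]] := iota_frac q.
have [|l [c c_series]] := composition_seriesP R_noetherian R_local R_dim1 R_red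
    (ideal_principal x) _ x_reg; first by exists 1; rewrite mul1r.
(* The relation is homogeneous of degree l in a and b; dividing by b^l makes it a polynomial
   relation for a / b. *)
have [|v [i [vi v_rel]]] := unit_relation R_noetherian R_local R_dim1 R_red mx x_reg c_series
    (g := fun i : 'I_l.+1 => a ^+ i * b ^+ (l - i)).
  by exists ord0; rewrite expr0 mul1r subn0; apply: lregX.
exists (rVpoly v), i; rewrite coef_rVpoly_ord; split=> //.
have bl_unit : iota (b ^+ l) \is a GRing.unit by rewrite rmorphXn unitrX ?iota_unit.
apply: (mulrI bl_unit); rewrite mulr0 (@horner_coef_wide _ l.+1); last first.
  by rewrite (leq_trans (size_poly _ _)) ?size_poly.
transitivity (iota (\sum_j v 0 j * (a ^+ j * b ^+ (l - j)))); last by rewrite v_rel rmorph0.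
rewrite mulr_sumr rmorph_sum; apply: eq_bigr => j _.
rewrite coef_map coef_rVpoly_ord !rmorphM !rmorphXn exprMn exprVn.
rewrite -{1}(subnK (ltnSE (ltn_ord j))) exprD.
transitivity (iota (v 0 j) * (iota a ^+ j * iota b ^+ (l - j)) * (iota b ^+ j / iota b ^+ j)).
  by ring.
by rewrite divrr ?mulr1 // unitrX ?iota_unit.
Qed.

Lemma pair_invertible (a b : Q) : exists phi psi,
  [/\ (a * phi + b * psi) * a = a, (a * phi + b * psi) * b = b,
      O (a * phi), O (a * psi) & O (b * phi) /\ O (b * psi)].
Proof.
have unit_case c : c \is a GRing.unit -> exists phi psi,
    [/\ a * phi + c * psi = 1, O (a * phi), O (a * psi) & O (c * phi) /\ O (c * psi)].
  move=> c_unit; have [f [k [fk fq]]] := unit_coefficient (a / c); set q := a / c in fq.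
  have f_neq0 : f != 0.
    by apply/eqP => f0; move/eqP: fk; rewrite f0 coef0 eq_sym oner_eq0.
  (* Horner's rule B j = q B j.+1 + f_j shows that q B j is integral as well, and f_k = 1 gives B k
     - q B k.+1 = 1. *)
  pose B j := (map_poly iota (drop_poly j f)).[q].
  have OB j : O (B j) by apply: seidenberg.
  have BS j : B j = q * B j.+1 + iota f`_j.
    rewrite /B; have -> : drop_poly j f = drop_poly j.+1 f * 'X + (f`_j)%:P.
      apply/polyP=> i; rewrite coefD coefMX coefC !coef_drop_poly.
      by case: i => [|i]; rewrite ?add0r ?addr0 //= addSnnS.
    rewrite rmorphD rmorphM /= map_polyX map_polyC hornerD hornerM hornerX hornerC /=.
    by rewrite mulrC.
  have OqB j : O (q * B j).
    case: j => [|j]; first by rewrite /B drop_poly0l fq mulr0; apply: integral0.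
    rewrite -(addrK (iota f`_j) (q * _)) -BS.
    by apply: integral_sub => //; apply: integral_id.
  have Bk : B k = q * B k.+1 + 1 by rewrite BS fk rmorph1.
  exists (- B k.+1 / c), (B k / c).
  have -> : a * (- B k.+1 / c) = - (q * B k.+1) by rewrite /q; ring.
  have -> : a * (B k / c) = q * B k by rewrite /q; ring.
  have cK y : c * (y / c) = y by rewrite mulrCA mulrV ?mulr1.
  rewrite !cK; split.
  - by rewrite Bk addrA addNr add0r.
  - exact: integral_opp.
  - exact: OqB.
  - by split=> //; apply: integral_opp.
have [b' bb'] := quasi_inverse b; have [a' aa'] := quasi_inverse a.
(* e is the idempotent supporting b. On e the element b agrees with the unit b + (1 - e); on 1 - e,
   where b vanishes, a quasi-inverse of a serves. *)
pose e := b * b'; have eb : e * b = b by [].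
have ee : e * e = e by rewrite /e mulrA bb'.
have Oe : O e by apply: integral_idempotent.
have O1e : O (1 - e) by apply: integral_sub; [exact: integral1|].
have Oa : O (a * a') by apply: integral_idempotent; rewrite mulrA aa'.
have c_unit : b + (1 - e) \is a GRing.unit.
  apply/unitrP; exists (e * b' + (1 - e)).
  suff E : (b + (1 - e)) * (e * b' + (1 - e)) = 1 by split=> //; rewrite mulrC.
  transitivity (1 + (e * b - b) * b' + (b * b' - e) + (b - e * b) + (e - e * e) * b' + (e * e - e)).
    by ring.
  by rewrite ee eb -/e !subrr mul0r !addr0.
have [phi [psi [def1 Oaphi Oapsi [Ocphi Ocpsi]]]] := unit_case _ c_unit.
have ec : e * (b + (1 - e)) = b by rewrite mulrDr eb mulrBr mulr1 ee subrr addr0.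
exists (e * phi + (1 - e) * a'), (e * psi).
have aphi : a * (e * phi + (1 - e) * a') = e * (a * phi) + (1 - e) * (a * a') by ring.
have apsi : a * (e * psi) = e * (a * psi) by ring.
have bphi : b * (e * phi + (1 - e) * a') = e * ((b + (1 - e)) * phi).
  rewrite mulrA ec.
  transitivity ((e * b) * phi + (b - e * b) * a'); first by ring.
  by rewrite eb subrr mul0r addr0.
have bpsi : b * (e * psi) = e * ((b + (1 - e)) * psi).
  by rewrite [RHS]mulrA ec mulrA (mulrC b e) eb.
have sumE : a * (e * phi + (1 - e) * a') + b * (e * psi) = e + (1 - e) * (a * a').
  by rewrite aphi bpsi addrAC -mulrDr def1 mulr1.
split.
- by rewrite sumE mulrDl -[(1 - e) * _ * a]mulrA aa'; ring.
- rewrite sumE mulrDl eb.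
  transitivity (b + (b - e * b) * (a * a')); first by ring.
  by rewrite eb subrr mul0r addr0.
- by rewrite aphi; apply: integral_add; apply: integral_mul.
- by rewrite apsi; apply: integral_mul.
- by rewrite bphi bpsi; split; apply: integral_mul.
Qed.

(** Induction on p. The products phi_i c_i of the shorter column act as weights of a partition of
    unity: each pair (c_i, z), with z the new entry, is treated by [pair_invertible]. On the
    complement 1 - eps of the support of the shorter column, a quasi-inverse of z serves. *)
Lemma column_invertible (p : nat) (c : 'I_p -> Q) : exists phi : 'I_p -> Q,
  (forall i j, O (c j * phi i)) /\ forall k, (\sum_i phi i * c i) * c k = c k.
Proof.
elim: p c => [|p IHp] c; first by exists (fun=> 0); split=> [[]|[]].
pose w := lift (@ord_max p); pose z := c ord_max.
have [phi [Ophi phiP]] := IHp (c \o w).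
have /choice [g gP] : forall i, exists g : Q * Q,
    [/\ (c (w i) * g.1 + z * g.2) * c (w i) = c (w i), (c (w i) * g.1 + z * g.2) * z = z,
        O (c (w i) * g.1), O (c (w i) * g.2) & O (z * g.1) /\ O (z * g.2)].
  by move=> i; have [f [h fhP]] := pair_invertible (c (w i)) z; exists (f, h).
have [z' zz'] := quasi_inverse z.
pose eps := \sum_i phi i * c (w i).
have eps_c k : eps * c (w k) = c (w k) by apply: phiP.
have Oeps : O eps by apply: integral_sum => i _; rewrite mulrC; apply: (Ophi i i).
have O1eps : O (1 - eps) by apply: integral_sub; [exact: integral1|].
have Oz : O (z * z') by apply: integral_idempotent; rewrite mulrA zz'.
pose last := \sum_i (phi i * c (w i)) * (g i).2 + (1 - eps) * z'.
pose Phi k := if unlift ord_max k is Some i then (phi i * c (w i)) * (g i).1 else last.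
have Phiw i : Phi (w i) = (phi i * c (w i)) * (g i).1 by rewrite /Phi liftK.
have Phim : Phi ord_max = last by rewrite /Phi unlift_none.
exists Phi; split=> [k j|k].
  have [i ->|->] := unliftP ord_max k; have [i' ->|->] := unliftP ord_max j.
  - rewrite -/(w i) -/(w i') Phiw.
    have -> : c (w i') * (phi i * c (w i) * (g i).1) = (c (w i') * phi i) * (c (w i) * (g i).1) by ring.
    by apply: integral_mul; [apply: Ophi|case: (gP i)].
  - rewrite -/(w i) -/z Phiw.
    have -> : z * (phi i * c (w i) * (g i).1) = (c (w i) * phi i) * (z * (g i).1) by ring.
    by apply: integral_mul; [apply: Ophi|case: (gP i) => _ _ _ _ []].
  - rewrite -/(w i') Phim /last mulrDr mulr_sumr; apply: integral_add.
      apply: integral_sum => i _.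
      have -> : c (w i') * (phi i * c (w i) * (g i).2) = (c (w i') * phi i) * (c (w i) * (g i).2) by ring.
      by apply: integral_mul; [apply: Ophi|case: (gP i)].
    have -> : c (w i') * ((1 - eps) * z') = (c (w i') - eps * c (w i')) * z' by ring.
    by rewrite eps_c subrr mul0r; apply: integral0.
  - rewrite -/z Phim /last mulrDr mulr_sumr; apply: integral_add.
      apply: integral_sum => i _.
      have -> : z * (phi i * c (w i) * (g i).2) = (c (w i) * phi i) * (z * (g i).2) by ring.
      by apply: integral_mul; [apply: Ophi|case: (gP i) => _ _ _ _ []].
    by rewrite mulrCA; apply: integral_mul.
have sumE : \sum_i Phi i * c i =
    \sum_i (phi i * c (w i)) * (c (w i) * (g i).1 + z * (g i).2) + (1 - eps) * (z * z').
  rewrite (bigD1_ord ord_max) //= Phim /last addrC mulrDl addrA mulr_suml -big_split /=.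
  congr (_ + _); last by rewrite /z; ring.
  by apply: eq_bigr => i _; rewrite -/(w i) Phiw /z; ring.
rewrite sumE mulrDl mulr_suml; have [i ->|->] := unliftP ord_max k.
  rewrite -/(w i).
  have -> : (1 - eps) * (z * z') * c (w i) = (c (w i) - eps * c (w i)) * (z * z') by ring.
  rewrite eps_c subrr mul0r addr0 -[RHS]eps_c /eps mulr_suml; apply: eq_bigr => j _.
  have [gj _ _ _ _] := gP j; rewrite -{3}gj; ring.
rewrite -/z; transitivity (eps * z + (1 - eps) * (z * z' * z)); last by rewrite zz'; ring.
congr (_ + _); last by ring.
rewrite /eps mulr_suml; apply: eq_bigr => j _.
have [_ gj _ _ _] := gP j; by rewrite -{3}gj mulrA.
Qed.

(* The row space of A over the integral closure is projective. *)
Lemma matrix_invertible (p n : nat) (A : 'M[Q]_(p, n)) : exists Phi : 'M[Q]_(n, p),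
  (forall i j, O ((A *m Phi) i j)) /\ A *m Phi *m A = A.
Proof.
have O_mul (k l s : nat) (B : 'M[Q]_(k, l)) (C : 'M[Q]_(l, s)) : (forall i j, O (B i j)) ->
    (forall i j, O (C i j)) -> forall i j, O ((B *m C) i j).
  move=> OB OC i j; rewrite mxE; apply: integral_sum => t _.
  by apply: integral_mul.
elim: n A => [|n IHn] A.
  exists 0; split=> [i j|]; first by rewrite mulmx0 mxE; apply: integral0.
  by rewrite mulmx0 mul0mx [RHS]thinmx0.
rewrite -[n.+1]/(1 + n)%N in A *.
pose c := lsubmx A; pose A1 := rsubmx A.
have [phi [Ophi phiP]] := column_invertible (fun i => c i 0).
pose Phc : 'rV[Q]_p := \row_i phi i; pose P := c *m Phc.
have OP i j : O (P i j) by rewrite mxE big_ord1 [Phc _ _]mxE; apply: Ophi.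
have Pc : P *m c = c.
  apply/colP=> k; rewrite -mulmxA mxE big_ord1 mulrC -[RHS]phiP; congr (_ * _).
  by rewrite mxE; apply: eq_bigr => i _; rewrite [Phc _ _]mxE.
(* P fixes the first column, so E = 1 - P kills it, and applying the induction hypothesis to E A1
   leaves that column undisturbed. *)
have [E defE] : exists E, E = 1%:M - P by exists (1%:M - P).
pose A2 := E *m A1; have [Ph2 [O2 A2P]] := IHn A2.
pose P2 := A2 *m Ph2.
have EA : A2 *m Ph2 *m E = A1 *m Ph2 *m E - P *m A1 *m Ph2 *m E.
  by rewrite /A2 {1}defE !mulmxBl mul1mx.
have defP2 : P + P2 *m E = A *m col_mx (Phc - Phc *m A1 *m Ph2 *m E) (Ph2 *m E).
  by rewrite -[A]hsubmxK mul_row_col -/c -/A1 mulmxBr !mulmxA -/P EA addrA addrAC.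
exists (col_mx (Phc - Phc *m A1 *m Ph2 *m E) (Ph2 *m E)); rewrite -defP2; split.
  move=> i j; rewrite mxE; apply: integral_add => //; apply: O_mul => // k l.
  have -> : E k l = (k == l)%:R - P k l.
    by rewrite defE mxE [X in X + _]mxE [X in _ + X]mxE.
  apply: integral_sub => //.
  by case: (k == l); [exact: integral1|exact: integral0].
have Ec : (P + P2 *m E) *m c = c.
  have E0 : E *m c = 0 by rewrite defE mulmxBl mul1mx Pc subrr.
  by rewrite mulmxDl Pc -mulmxA E0 mulmx0 addr0.
have EA1 : (P + P2 *m E) *m A1 = A1.
  by rewrite mulmxDl -(mulmxA P2) [P2 *m _]A2P /A2 defE mulmxBl mul1mx addrC subrK.
by rewrite -{1}[A]hsubmxK mul_mx_row Ec EA1 hsubmxK.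
Qed.

(** r A Phi has entries in R because A Phi is integral and r is in the conductor. Over Q both
    conditions follow from A Phi A = A, and they descend along the injection iota. *)
Lemma conductor_factors (r : R) (p n : nat) (A : 'M[R]_(p, n)) :
  conductor iota (iota r) -> factors_through_free r A.
Proof.
move=> [_ r_cond]; have [iota_inj _ _] := Q_total.
have [Phi [OPhi PhiP]] := matrix_invertible (map_mx iota A).
have /choice [X0 X0P] : forall ij : 'I_p * 'I_p, exists y,
    iota y = iota r * (map_mx iota A *m Phi) ij.1 ij.2.
  by move=> ij; have [y _ yP] := r_cond _ (OPhi ij.1 ij.2); exists y.
pose X := \matrix_(i, j) X0 (i, j).
have XE : map_mx iota X = iota r *: (map_mx iota A *m Phi).
  by apply/matrixP=> i j; rewrite !mxE X0P !mxE.
have map_inj k l (B C : 'M[R]_(k, l)) : map_mx iota B = map_mx iota C -> B = C.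
  by move=> BC; apply/matrixP => i j; apply: iota_inj; have /matrixP/(_ i j) := BC; rewrite !mxE.
exists X; split.
  apply: map_inj; rewrite map_mxM /= XE -scalemxAl PhiP.
  by rewrite map_mxZ.
move=> v v0; apply: map_inj; rewrite map_mxM /= XE -scalemxAr mulmxA -map_mxM v0.
by rewrite !map_mx0 mul0mx scaler0.
Qed.

End IntegralClosure.

(** * Comparison of resolutions and annihilation of Ext *)

Section Comparison.
Variable R : comNzRingType.

(** d may fail to be onto; corestricting it and phi to the range of d makes projectivity
    applicable. *)
Lemma projective_lift (P A B : lmodType R) (phi : P -> B) (d : {linear A -> B}) :
  projective_module P -> linear phi -> (forall y, exists z, d z = phi y) ->
  exists psi : {linear P -> A}, forall y, d (psi y) = phi y.
Proof.
move=> P_proj phi_lin im_phi; pose D := [set y | exists z, d z = y].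
have hD : submodule D.
  split; first by exists 0; rewrite linear0.
  by move=> a _ _ [y <-] [z <-]; exists (a *: y + z); rewrite linearP.
have Dd z : D (d z) by exists z.
pose phi0 y : submod_type hD := submod_in hD (im_phi y).
pose d0 z : submod_type hD := submod_in hD (Dd z).
have phi0_lin : linear phi0 by move=> a y z; apply/val_inj; rewrite /= phi_lin.
have d0_lin : linear d0 by move=> a y z; apply/val_inj; rewrite /= linearP.
pose phiL : {linear P -> submod_type hD} :=
  HB.pack phi0 (GRing.isLinear.Build R P (submod_type hD) *:%R phi0 phi0_lin).
pose dL : {linear A -> submod_type hD} :=
  HB.pack d0 (GRing.isLinear.Build R A (submod_type hD) *:%R d0 d0_lin).
have [|psi psiP] := P_proj _ _ dL phiL.
  by move=> [b Db]; have /asboolP [z zb] := Db; exists z; apply/val_inj.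
by exists psi => y; have /(congr1 val) := psiP y.
Qed.

(** [kills_ext] ranges over all projective resolutions F, whereas factorisations concern the
    matrices of a free one, G. Two consecutive degrees are enough to carry the induction. *)
Lemma comparison (M : lmodType R) (F G : projective_resolution M) (i : nat) :
  exists (a0 : {linear F i -> G i}) (a1 : {linear F i.+1 -> G i.+1})
         (b0 : {linear G i -> F i}) (b1 : {linear G i.+1 -> F i.+1})
         (h0 : {linear F i -> F i.+1}) (h1 : {linear F i.+1 -> F i.+2}),
  [/\ forall y, a0 (res_diff F i y) = res_diff G i (a1 y),
      forall y, b0 (res_diff G i y) = res_diff F i (b1 y) &
      forall y, y - b1 (a1 y) = res_diff F i.+1 (h1 y) + h0 (res_diff F i y)].
Proof.
have dd (K : projective_resolution M) k y : res_diff K k (res_diff K k.+1 y) = 0.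
  by apply/res_diff_exact; exists y.
have daug (K : projective_resolution M) y : res_aug K (res_diff K 0 y) = 0.
  by apply/res_aug_exact; exists y.
elim: i => [|i [a0 [a1 [b0 [b1 [h0 [h1 [a01 b01 h01]]]]]]]].
  have augmap (K L : projective_resolution M) : exists a : {linear K 0%N -> L 0%N},
      forall y, res_aug L (a y) = res_aug K y.
    apply: (@projective_lift (K 0%N) (L 0%N) M (res_aug K)); first exact: res_projective.
      exact: linearP.
    by move=> y; apply: res_aug_surj.
  have nextmap (K L : projective_resolution M) (a : {linear K 0%N -> L 0%N}) :
      (forall y, res_aug L (a y) = res_aug K y) ->
      exists a' : {linear K 1%N -> L 1%N}, forall y, res_diff L 0 (a' y) = a (res_diff K 0 y).
    move=> aP; apply: projective_lift; first exact: res_projective.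
      by move=> c y z; rewrite !linearP.
    by move=> y; apply/res_aug_exact; rewrite aP daug.
  have [a0 a0P] := augmap F G; have [b0 b0P] := augmap G F.
  have [a1 a1P] := nextmap F G a0 a0P; have [b1 b1P] := nextmap G F b0 b0P.
  have [|||h0 h0P] := @projective_lift (F 0%N) (F 1%N) (F 0%N) (fun y => y - b0 (a0 y)) (res_diff F 0).
  - exact: res_projective.
  - by move=> c y z; rewrite (linearP a0) (linearP b0) opprD addrACA scalerBr.
  - by move=> y; apply/res_aug_exact; rewrite linearB /= b0P a0P subrr.
  have [|||h1 h1P] := @projective_lift (F 1%N) (F 2%N) (F 1%N)
      (fun y => y - b1 (a1 y) - h0 (res_diff F 0 y)) (res_diff F 1).
  - exact: res_projective.
  - move=> c y z; rewrite (linearP a1) (linearP b1) (linearP (res_diff F 0)) (linearP h0).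
    by rewrite !opprD [X in X + _ = _]addrACA [LHS]addrACA !scalerBr.
  - move=> y; apply/res_diff_exact; rewrite !linearB /= h0P b1P a1P.
    by rewrite subrr.
  exists a0, a1, b0, b1, h0, h1; split=> // y.
  by rewrite h1P subrK.
have nextmap (K L : projective_resolution M) (a : {linear K i -> L i}) (a' : {linear K i.+1 -> L i.+1}) :
    (forall y, a (res_diff K i y) = res_diff L i (a' y)) ->
    exists a2 : {linear K i.+2 -> L i.+2}, forall y, res_diff L i.+1 (a2 y) = a' (res_diff K i.+1 y).
  move=> aP; apply: projective_lift; first exact: res_projective.
    by move=> c y z; rewrite !linearP.
  by move=> y; apply/res_diff_exact; rewrite -aP dd linear0.
have [a2 a2P] := nextmap F G a0 a1 a01; have [b2 b2P] := nextmap G F b0 b1 b01.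
have [|||h2 h2P] := @projective_lift (F i.+2) (F i.+3) (F i.+2)
    (fun y => y - b2 (a2 y) - h1 (res_diff F i.+1 y)) (res_diff F i.+2).
- exact: res_projective.
- move=> c y z; rewrite (linearP a2) (linearP b2) (linearP (res_diff F i.+1)) (linearP h1).
  by rewrite !opprD [X in X + _ = _]addrACA [LHS]addrACA !scalerBr.
- move=> y; apply/res_diff_exact; rewrite !linearB /= b2P a2P h01 dd linear0 addr0.
  by rewrite subrr.
exists a1, a2, b1, b2, h1, h2; split=> // y.
by rewrite h2P subrK.
Qed.

Hypothesis R_noetherian : noetherian R.

(** Transport a cocycle to f' on the free resolution. If X factors r on the row space of [A j], then
    r - X lifts through [A j.+1] to a matrix Z, and f' composed with Z is a primitive of r f'. *)
Lemma factors_annihilator (m : set R) (r : R) : local_ring m ->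
  (forall (p n : nat) (A : 'M[R]_(p, n)), factors_through_free r A) ->
  cohomology_annihilator_from R 2 r.
Proof.
move=> R_local r_factors [|[|j]] // M N _ M_fg _ F f [f_lin fd].
have [n [g [A [g_surj g_exact A_exact _]]]] := minimal_free_resolution R_noetherian R_local M_fg.
pose G := free_resolution g_surj g_exact A_exact.
have [a0 [a1 [b0 [b1 [h0 [h1 [a01 b01 h01]]]]]]] := comparison F G j.+1.
have dd (k : nat) (y : F k.+2) : res_diff F k (res_diff F k.+1 y) = 0.
  by apply/res_diff_exact; exists y.
pose fL : {linear F j.+2 -> N} := HB.pack f (GRing.isLinear.Build R (F j.+2) N *:%R f f_lin).
have f0 y : res_diff F j.+1 y = 0 -> fL y = 0.
  by move=> /res_diff_exact [z <-]; apply: fd.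
pose f' : 'rV[R]_(n j.+2) -> N := fun v => fL (b1 v).
have f'_ker v : v *m A j.+1 = 0 -> f' v = 0.
  by move=> v0; apply: f0; rewrite -b01 /= v0 linear0.
have [X [XA Xker]] := r_factors _ _ (A j).
have /choice [z zP] : forall i, exists z, z *m A j.+1 = row i (r%:M - X).
  move=> i; apply/A_exact; rewrite -row_mul mulmxBl mul_scalar_mx XA subrr row0 //.
pose Z := \matrix_i z i.
have ZP : Z *m A j.+1 = r%:M - X.
  by apply/row_matrixP => i; rewrite row_mul rowK zP.
have AZ (v : 'rV_(n j.+2)) : f' (v *m A j.+1 *m Z) = r *: f' v.
  apply/eqP; rewrite -subr_eq0; apply/eqP; rewrite /f' -!linearZ -!linearB.
  have E : v *m A j.+1 *m Z *m A j.+1 = r *: (v *m A j.+1).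
    rewrite -[LHS]mulmxA ZP mulmxBr mul_mx_scalar Xker ?subr0 //.
    by apply/A_exact; exists v.
  by apply: f'_ker; rewrite mulmxBl E -scalemxAl subrr.
(* The first term pulls the primitive of r f' back to F; the second accounts for the homotopy
   between the identity and the composite b a. *)
exists (fun y => f' (a0 y *m Z) + r *: fL (h0 y)).
  have f'P c v w : f' (c *: v + w) = c *: f' v + f' w.
    by rewrite /f' (linearP b1) (linearP fL).
  move=> c y y'; rewrite (linearP a0) mulmxDl -scalemxAl f'P (linearP h0) (linearP fL).
  by rewrite !scalerDr !scalerA (mulrC r) addrACA.
apply/funext => y; rewrite -[LHS]/(r *: fL y) /= a01 AZ -scalerDr; congr (_ *: _).
rewrite /f' -[f y]/(fL y) -[f (h0 _)]/(fL (h0 _)) -[in LHS](subrK (b1 (a1 y)) y) h01 addrAC !(linearD fL).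
by rewrite (f0 (res_diff F j.+2 _)) ?dd // add0r.
Qed.

End Comparison.

(** * Reducedness and the final equality *)

Lemma analytically_unramified_reduced (R : comNzRingType) (m : set R) :
  adically_complete m -> analytically_unramified m -> reduced R.
Proof.
(* A nilpotent element dies in the completion, hence lies in every power of m, and R is
   separated. *)
move=> [m_sep _] [Rh [j [[_ j_adic _] Rh_red]]] x n xn0; apply: m_sep => k.
apply/j_adic; have -> : j x = 0 by apply: (Rh_red _ n); rewrite -rmorphXn xn0 rmorph0.
by case: k => [|k] //; apply: (submodule_span_submodule _).1.
Qed.

Theorem theorem2 (R : comNzRingType) (m : set R)
    (Q : comUnitRingType) (iota : {rmorphism R -> Q})
    (R_noetherian : noetherian R)
    (R_local : local_ring m)
    (R_dim1 : krull_dim R 1)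
    (R_complete : adically_complete m)
    (R_unramified : analytically_unramified m)
    (R_almost_gorenstein : almost_gorenstein m)
    (Q_total : total_quotient_ring iota) :
  [set iota r | r in cohomology_annihilator R] = conductor iota.
Proof.
have R_red := analytically_unramified_reduced R_complete R_unramified.
apply/seteqP; split=> [_ [r r_ca <-]|q q_cond].
  split; first exact: integral_id.
  move=> x; exact: (annihilator_conductor R_noetherian R_local R_dim1 R_red).
(* An element q of the conductor is q * 1, with 1 integral, so it comes from R. *)
have [r _ def_q] := q_cond.2 1 (integral1 _); rewrite mulr1 in def_q.
exists r => //; exists 2%N => //; apply: (factors_annihilator R_noetherian R_local) => p n A.
have [w [u [x [_ mx x_reg _ _]]]] :=
  almost_gorenstein_canonical R_noetherian R_local R_dim1 R_red R_almost_gorenstein.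
apply: (conductor_factors R_noetherian R_local R_dim1 R_red Q_total mx x_reg).
by rewrite def_q.
Qed.
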